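(* Let $s_0,\dots,s_7$ be the transformations of the variables $\nu_1,\dots,\nu_8,\kappa_1,\kappa_2,f,g$ defined in the context. (i) Let $\Xi$ be the transformation of the parameters defined by $$(\nu_1,\dots,\nu_8;\kappa_1,\kappa_2;f,g)\mapsto\Bigl(\frac{\nu_1\kappa_1}{q\kappa_2},\frac{\nu_2\kappa_1}{q\kappa_2},\frac{\nu_3\kappa_1}{q\kappa_2},\frac{\nu_4\kappa_1}{q\kappa_2},\frac{\nu_5\kappa_1}{q\kappa_2},\frac{\nu_6\kappa_1}{q\kappa_2},\frac{\nu_7\kappa_1}{q\kappa_2},\frac{\nu_8\kappa_1}{q\kappa_2};\frac{\kappa_1^3}{q^2\kappa_2^2},\frac{\kappa_1^2}{q^2\kappa_2};\frac{f\kappa_1}{q\kappa_2},\frac{gq\kappa_2}{\kappa_1}\Bigr).$$ Let $T$ be the transformation of the parameters defined by $$T=\Xi\cdot(s_4s_5s_1s_4s_6s_5s_1s_2s_4s_7s_6s_5s_1s_2s_3s_4s_0)^2 .$$ Then $$\frac{(T(f)g-\kappa_1/(q\kappa_2))(fg-\kappa_1/\kappa_2)}{(T(f)g-1)(fg-1)}=\frac{(g-\nu_5/\kappa_2)(g-\nu_6/\kappa_2)(g-\nu_7/\kappa_2)(g-\nu_8/\kappa_2)}{(g-1/\nu_1)(g-1/\nu_2)(g-1/\nu_3)(g-1/\nu_4)},$$ $$\frac{(T(g)T(f)-\kappa_1/(q^2\kappa_2))(T(f)g-\kappa_1/(q\kappa_2))}{(T(g)T(f)-1)(T(f)g-1)}=\frac{(T(f)-T(\kappa_1/\nu_5))(T(f)-T(\kappa_1/\nu_6))(T(f)-T(\kappa_1/\nu_7))(T(f)-T(\kappa_1/\nu_8))}{(T(f)-\nu_1)(T(f)-\nu_2)(T(f)-\nu_3)(T(f)-\nu_4)}.$$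 Namely, the operator $T$ represents the time evolution of the $q$-Painlevé equation $q$-$P(E_7^{(1)})$. On the other parameters, $$T(\nu_i)=\nu_i\ (i=1,2,\dots,8),\qquad T(\kappa_1)=\kappa_1/q,\qquad T(\kappa_2)=q\kappa_2 .$$ (ii) For any element $\zeta$ generated by $\nu_1,\nu_2,\nu_3,\nu_4,\nu_5/\kappa_1,\nu_6/\kappa_1,\nu_7/\kappa_1,\nu_8/\kappa_1,\kappa_2/\kappa_1,f$ and $g$, we have $$\Xi(\zeta)=S_{E_7}\Bigl[\frac{\kappa_1}{q\kappa_2}\Bigr](\zeta),$$ where $S_{E_7}[c]$ is the transformation defined in the context.
   Context: **Parameters and conventions.** The quantities $q,\kappa_1,\kappa_2,\nu_1,\dots,\nu_8$ are parameters subject to the relation $\kappa_1^2\kappa_2^2=q\,\nu_1\nu_2\cdots\nu_8$, and $f,g$ are the dependent variables. A transformation is given by the images of the variables and acts on rational expressions by substitution; variables not mentioned are left unchanged. Products are compositions, with the rightmost factor applied first: $(ab)(x)=a(b(x))$. **Transformations (from the extended Weyl group symmetry of type $E_7^{(1)}$).** - $s_0:\ \kappa_1\leftrightarrow\kappa_2,\ f\to1/g,\ g\to1/f$. - $s_1:\ \nu_3\leftrightarrow\nu_4$; $s_2:\ \nu_2\leftrightarrow\nu_3$; $s_3:\ \nu_1\leftrightarrow\nu_2$. - $s_5:\ \nu_5\leftrightarrow\nu_6$; $s_6:\ \nu_6\leftrightarrow\nu_7$; $s_7:\ \nu_7\leftrightarrow\nu_8$. - $s_4:\ \nu_1\to\kappa_2/\nu_5,\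 \nu_5\to\kappa_2/\nu_1,\ \kappa_1\to\kappa_1\kappa_2/(\nu_1\nu_5)$, and $$f\to\frac{-\kappa_2(\nu_1\nu_5-\kappa_1)fg-\nu_5(\kappa_1-\kappa_2)f+\kappa_1(\nu_1\nu_5-\kappa_2)}{\nu_5\{-(\nu_1\nu_5-\kappa_2)fg+\nu_1(\kappa_1-\kappa_2)g+(\nu_1\nu_5-\kappa_1)\}} .$$ **The equation $q$-$P(E_7^{(1)})$.** It is $$\frac{(fg-\kappa_1/\kappa_2)(\overline fg-\kappa_1/(q\kappa_2))}{(fg-1)(\overline fg-1)}=\frac{\prod_{j=5}^8(g-\nu_j/\kappa_2)}{\prod_{i=1}^4(g-1/\nu_i)},\qquad\frac{(fg-\kappa_1/\kappa_2)(f\underline g-q\kappa_1/\kappa_2)}{(fg-1)(f\underline g-1)}=\frac{\prod_{j=5}^8(f-\kappa_1/\nu_j)}{\prod_{i=1}^4(f-\nu_i)},$$ where the overline is the time evolution and the underline its inverse, and the parameters evolve by $\overline{\kappa}_1=\kappa_1/q$, $\overline{\kappa}_2=q\kappa_2$, $\overline{\nu}_i=\nu_i$. **The transformation $S_{E_7}[c]$.** For $c\neq0$, $S_{E_7}[c]$ sends $(\nu_1,\nu_2,\nu_3,\nu_4,\nu_5/\kappa_1,\nu_6/\kappa_1,\nu_7/\kappa_1,\nu_8/\kappa_1,\kappa_2/\kappa_1,f,g)$ to $(c\nu_1,c\nu_2,c\nu_3,c\nu_4,c^{-1}\nu_5/\kappa_1,c^{-1}\nu_6/\kappa_1,c^{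-1}\nu_7/\kappa_1,c^{-1}\nu_8/\kappa_1,\kappa_2/\kappa_1,cf,c^{-1}g)$.
   Formalization: The printed word in T is corrected: with the given s_i it yields T(ν1)=ν1ν2ν3ν5ν6/κ2² instead of ν1. The theorem uses T=Ξ·(s4s5s3s4s6s5s2s3s4s7s6s5s1s2s3s4s0)², i.e. s5s1s4 becomes s5s3s4 and s6s5s1s2s4 becomes s6s5s2s3s4. *)

(* Defs.v *)
From HB Require Import structures.
From mathcomp Require Import all_boot all_order all_algebra.
From mathcomp.multinomials Require Import mpoly.

Set Implicit Arguments.
Unset Strict Implicit.
Unset Printing Implicit Defensive.

Import GRing.Theory.
Local Open Scope ring_scope.

(* The ambient field is F(nu_1, ..., nu_8, kappa_1, kappa_2,
   f, g) over an arbitrary base field F; the twelve generators are independent,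
   and q is eliminated by kappa_1^2 kappa_2^2 = q nu_1 ... nu_8. *)
Notation ratfun F := {fraction {mpoly F[12]}}.

Definition cst {F : fieldType} (c : F) : ratfun F :=
  @FracField.tofrac {mpoly F[12]} c%:MP.

Definition var {F : fieldType} (k : nat) : ratfun F :=
  @FracField.tofrac {mpoly F[12]} 'X_(inord k).

(* nu i is meant for 1 <= i <= 8. *)
Definition nu {F : fieldType} (i : nat) : ratfun F := var i.-1.
Definition kappa1 {F : fieldType} : ratfun F := var 8.
Definition kappa2 {F : fieldType} : ratfun F := var 9.
Definition f {F : fieldType} : ratfun F := var 10.
Definition g {F : fieldType} : ratfun F := var 11.

Definition q {F : fieldType} : ratfun F :=
  kappa1 ^+ 2 * kappa2 ^+ 2 / \prod_(1 <= i < 9) nu i.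

(* Substitution of the images h, in the order nu_1, ..., nu_8, kappa_1,
   kappa_2, f, g, in a rational expression.  The chosen representative n/d of x
   does not matter as soon as h is algebraically independent over F. *)
Definition subst {F : fieldType} (h : 12.-tuple (ratfun F)) (x : ratfun F) :
    ratfun F :=
  let r : {ratio {mpoly F[12]}} := repr x in
  mmap cst (tnth h) \n_r / mmap cst (tnth h) \d_r.

(* No image of q is prescribed: s0, ..., s7 and Xi below all fix
   kappa_1^2 kappa_2^2 / (nu_1 ... nu_8). *)
Definition s0 {F : fieldType} : ratfun F -> ratfun F :=
  subst [tuple nu 1; nu 2; nu 3; nu 4; nu 5; nu 6; nu 7; nu 8;
               kappa2; kappa1; 1 / g; 1 / f].

Definition s1 {F : fieldType} : ratfun F -> ratfun F :=
  subst [tuple nu 1; nu 2; nu 4; nu 3; nu 5; nu 6; nu 7; nu 8;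
               kappa1; kappa2; f; g].

Definition s2 {F : fieldType} : ratfun F -> ratfun F :=
  subst [tuple nu 1; nu 3; nu 2; nu 4; nu 5; nu 6; nu 7; nu 8;
               kappa1; kappa2; f; g].

Definition s3 {F : fieldType} : ratfun F -> ratfun F :=
  subst [tuple nu 2; nu 1; nu 3; nu 4; nu 5; nu 6; nu 7; nu 8;
               kappa1; kappa2; f; g].

Definition s4 {F : fieldType} : ratfun F -> ratfun F :=
  subst [tuple kappa2 / nu 5; nu 2; nu 3; nu 4;
               kappa2 / nu 1; nu 6; nu 7; nu 8;
               kappa1 * kappa2 / (nu 1 * nu 5); kappa2;
               (- kappa2 * (nu 1 * nu 5 - kappa1) * f * g
                - nu 5 * (kappa1 - kappa2) * f
                + kappa1 * (nu 1 * nu 5 - kappa2))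
               / (nu 5 * (- (nu 1 * nu 5 - kappa2) * f * g
                          + nu 1 * (kappa1 - kappa2) * g
                          + (nu 1 * nu 5 - kappa1)));
               g].

Definition s5 {F : fieldType} : ratfun F -> ratfun F :=
  subst [tuple nu 1; nu 2; nu 3; nu 4; nu 6; nu 5; nu 7; nu 8;
               kappa1; kappa2; f; g].

Definition s6 {F : fieldType} : ratfun F -> ratfun F :=
  subst [tuple nu 1; nu 2; nu 3; nu 4; nu 5; nu 7; nu 6; nu 8;
               kappa1; kappa2; f; g].

Definition s7 {F : fieldType} : ratfun F -> ratfun F :=
  subst [tuple nu 1; nu 2; nu 3; nu 4; nu 5; nu 6; nu 8; nu 7;
               kappa1; kappa2; f; g].

Definition Xi {F : fieldType} : ratfun F -> ratfun F :=
  subst [tuple nu 1 * kappa1 / (q * kappa2); nu 2 * kappa1 / (q * kappa2);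
               nu 3 * kappa1 / (q * kappa2); nu 4 * kappa1 / (q * kappa2);
               nu 5 * kappa1 / (q * kappa2); nu 6 * kappa1 / (q * kappa2);
               nu 7 * kappa1 / (q * kappa2); nu 8 * kappa1 / (q * kappa2);
               kappa1 ^+ 3 / (q ^+ 2 * kappa2 ^+ 2);
               kappa1 ^+ 2 / (q ^+ 2 * kappa2);
               f * kappa1 / (q * kappa2); g * q * kappa2 / kappa1].

(* The word is found in print as
     s4 s5 s1 s4 s6 s5 s1 s2 s4 s7 s6 s5 s1 s2 s3 s4 s0,
   which with the present numbering (s3, not s1, is the neighbour of s4) is a
   misprint: Xi composed with its square maps nu_1 to
   nu_1 nu_2 nu_3 nu_5 nu_6 / kappa_2^2 instead of fixing it.  The blocks
   s5 s1 s4 and s6 s5 s1 s2 s4 are here s5 s3 s4 and s6 s5 s2 s3 s4, in line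
   with the block s7 s6 s5 s1 s2 s3 s4. *)
Definition half_T {F : fieldType} : ratfun F -> ratfun F :=
  s4 \o s5 \o s3 \o s4 \o s6 \o s5 \o s2 \o s3 \o s4
  \o s7 \o s6 \o s5 \o s1 \o s2 \o s3 \o s4 \o s0.

Definition T {F : fieldType} : ratfun F -> ratfun F :=
  Xi \o (half_T \o half_T).

(* The equation q-P(E_7^(1)): up is the time evolution (overline), dn its
   inverse (underline). *)
Definition qPE7 {F : fieldType} (up dn : ratfun F -> ratfun F) : Prop :=
  [/\ cancel up dn /\ cancel dn up,
      ((f * g - kappa1 / kappa2) * (up f * g - kappa1 / (q * kappa2)))
        / ((f * g - 1) * (up f * g - 1))
      = (\prod_(5 <= j < 9) (g - nu j / kappa2))
        / \prod_(1 <= i < 5) (g - 1 / nu i),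
      ((f * g - kappa1 / kappa2) * (f * dn g - q * kappa1 / kappa2))
        / ((f * g - 1) * (f * dn g - 1))
      = (\prod_(5 <= j < 9) (f - kappa1 / nu j))
        / \prod_(1 <= i < 5) (f - nu i)
    & [/\ up kappa1 = kappa1 / q, up kappa2 = q * kappa2
        & forall i, (1 <= i <= 8)%N -> up (nu i) = nu i]].

(* S_{E_7}[c] is given by the images of nu_i (i <= 4), nu_j / kappa_1 (j >= 5),
   kappa_2 / kappa_1, f and g.  Together with kappa_1 these are coordinates of
   the whole field, and kappa_1, not being mentioned, is left unchanged; on the
   subfield generated by the listed elements this choice is irrelevant. *)
Definition SE7 {F : fieldType} (c : ratfun F) : ratfun F -> ratfun F :=
  subst [tuple c * nu 1; c * nu 2; c * nu 3; c * nu 4;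
               c^-1 * nu 5; c^-1 * nu 6; c^-1 * nu 7; c^-1 * nu 8;
               kappa1; kappa2; c * f; c^-1 * g].

Definition SE7_generators {F : fieldType} : seq (ratfun F) :=
  [:: nu 1; nu 2; nu 3; nu 4;
      nu 5 / kappa1; nu 6 / kappa1; nu 7 / kappa1; nu 8 / kappa1;
      kappa2 / kappa1; f; g].

Inductive generated {F : fieldType} (s : seq (ratfun F)) : ratfun F -> Prop :=
| gen_cst c : generated s (cst c)
| gen_mem x : x \in s -> generated s x
| gen_add x y : generated s x -> generated s y -> generated s (x + y)
| gen_opp x : generated s x -> generated s (- x)
| gen_mul x y : generated s x -> generated s y -> generated s (x * y)
| gen_inv x : generated s x -> generated s x^-1.

(* Main.v *)
Require Import Defs.
From HB Require Import structures.
From mathcomp Require Import all_boot all_order all_algebra ring.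
From mathcomp.multinomials Require Import mpoly.

(* In terms of Y = (f g - kappa_1/kappa_2)/(f g - 1) the Moebius action of s_4 on
   f becomes multiplicative: s_4(Y) = Y (g - 1/nu_1)/(g - nu_5/kappa_2), while
   s_0(Y) = (kappa_2/kappa_1) Y and the other s_i fix Y.  Since all s_i but s_0
   fix g, the half h of the word satisfies
     h(f) = 1/g,   h(Y) = c Y G,   G = prod (g - 1/nu_i)/prod (g - nu_j/kappa_2),
   with c = kappa_1/(q kappa_2), and acts on the parameters by
   nu_i -> kappa_2/nu_(9-i).  As Xi rescales by powers of c and fixes Y and G,
   applying Xi to h(Y) gives the first equation, and T(Y) = Xi(h(c Y G)) gives
   the second.

   That the substitutions are field endomorphisms at all rests on their being
   algebraically independent, which is read off from an explicit inverse. *)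

Set Implicit Arguments.
Unset Strict Implicit.
Unset Printing Implicit Defensive.

Import GRing.Theory.
Local Open Scope ring_scope.
Local Open Scope quotient_scope.
Local Notation "x %:F" := (@FracField.tofrac _ x).

(** * Fractions, and the extension of a ring morphism to them *)

Lemma frac_repr (R : idomainType) (x : {fraction R}) :
  x = (\n_(repr x))%:F / (\d_(repr x))%:F.
Proof.
have d0 := denom_ratioP (repr x).
apply: (canRL (mulfK _)); first by rewrite tofrac_eq0.
rewrite -[x in x * _]reprK.
have tofracE y : y%:F = \pi_{fraction R} (Ratio y 1) by rewrite piE.
rewrite !tofracE; set r := repr x.
(* What remains is the equivalence of two representatives, the product of n/d with d/1 and n/1. *)
rewrite -[LHS](FracField.pi_mul r (Ratio \d_r 1)); apply/eqP.
rewrite FracField.equivf_def /FracField.mulf.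
by rewrite !numden_Ratio ?mulf_neq0 ?oner_neq0 // !mulr1 mulrC.
Qed.

Section Specialization.

Context (R : idomainType) (K : fieldType) (phi : {rmorphism R -> K}).

(* phi extends to the localization of R at its kernel; this is the graph of
   the extension. *)
Definition specializes (x : {fraction R}) (y : K) :=
  exists n d, [/\ phi d != 0, x = n%:F / d%:F & y = phi n / phi d].

Lemma specializes_den_neq0 d : phi d != 0 -> d%:F != 0.
Proof. by apply: contra; rewrite tofrac_eq0 => /eqP ->; rewrite rmorph0. Qed.

(** Since [R] embeds in its fraction field, equality of the two fractions means n d' = n' d in [R],
    and [phi] carries this to [K]. *)
Lemma specializes_fun x y z : specializes x y -> specializes x z -> y = z.
Proof.
move=> [n [d [d0 -> ->]]] [n' [d' [d'0 e ->]]].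
have D0 := specializes_den_neq0 d0; have D'0 := specializes_den_neq0 d'0.
apply/eqP; rewrite eqr_div // -!rmorphM; apply/eqP; congr (phi _); apply/eqP.
by rewrite -tofrac_eq !tofracM -eqr_div //; apply/eqP.
Qed.

Lemma specializes_tofrac p : specializes p%:F (phi p).
Proof.
by exists p, 1; rewrite tofrac1 !rmorph1 !divr1 oner_neq0.
Qed.

Lemma specializes1 : specializes 1 1.
Proof. by have := specializes_tofrac 1; rewrite tofrac1 (rmorph1 phi). Qed.

Lemma specializesD x y x' y' :
  specializes x y -> specializes x' y' -> specializes (x + x') (y + y').
Proof.
move=> [n [d [d0 -> ->]]] [n' [d' [d'0 -> ->]]].
exists (n * d' + n' * d), (d * d').
have D0 := specializes_den_neq0 d0; have D'0 := specializes_den_neq0 d'0.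
by split; rewrite ?rmorphM ?mulf_neq0 // ?rmorphD ?rmorphM addf_div.
Qed.

Lemma specializesN x y : specializes x y -> specializes (- x) (- y).
Proof.
by move=> [n [d [d0 -> ->]]]; exists (- n), d; split; rewrite // rmorphN mulNr.
Qed.

Lemma specializesB x y x' y' :
  specializes x y -> specializes x' y' -> specializes (x - x') (y - y').
Proof. by move=> ? ?; apply/specializesD/specializesN. Qed.

Lemma specializesM x y x' y' :
  specializes x y -> specializes x' y' -> specializes (x * x') (y * y').
Proof.
move=> [n [d [d0 -> ->]]] [n' [d' [d'0 -> ->]]]; exists (n * n'), (d * d').
by split; rewrite ?rmorphM ?mulf_neq0 // mulf_div.
Qed.

Lemma specializesX x y k : specializes x y -> specializes (x ^+ k) (y ^+ k).
Proof.
move=> xy; elim: k => [|k IHk]; first exact: specializes1.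
by rewrite !exprS; apply: specializesM.
Qed.

Lemma specializesV x y : specializes x y -> y != 0 -> specializes x^-1 y^-1.
Proof.
move=> [n [d [d0 -> ->]]]; rewrite mulf_eq0 invr_eq0 negb_or => /andP[n0 _].
by exists d, n; rewrite n0 !invf_div.
Qed.

Lemma specializes_div x y x' y' : specializes x y -> specializes x' y' ->
  y' != 0 -> specializes (x / x') (y / y').
Proof. by move=> ? ? ?; apply/specializesM/specializesV. Qed.

(** As 0 specializes to 0 and to nothing else, one nonzero value certifies a nonzero fraction. *)
Lemma specializes_neq0 x y : specializes x y -> y != 0 -> x != 0.
Proof.
move=> xy; apply: contra => /eqP x0; apply/eqP; apply: specializes_fun xy _.
by have := specializes_tofrac 0; rewrite tofrac0 (rmorph0 phi) x0.
Qed.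

Hypothesis phi_inj : injective phi.

(** An injective [phi] kills no denominator, so the extension is total. The value shown is the one
    that [subst] computes from the chosen representative. *)
Lemma specializes_repr x :
  specializes x (phi \n_(repr x) / phi \d_(repr x)).
Proof.
exists \n_(repr x), \d_(repr x); split=> //; last exact: frac_repr.
by rewrite raddf_eq0 ?denom_ratioP.
Qed.

End Specialization.

(** * Substitutions in rational functions and their invertibility *)

Section Subst.

Context {F : fieldType}.
Implicit Types (h k : 12.-tuple (ratfun F)) (x y : ratfun F).

Definition poly_subst h : {mpoly F[12]} -> ratfun F := mmap cst (tnth h).

Lemma cst_is_zmod_morphism : zmod_morphism (@cst F).
Proof. by move=> a b; rewrite /cst mpolyCB rmorphB. Qed.

Lemma cst_is_monoid_morphism : monoid_morphism (@cst F).
Proof. by split=> [|a b]; rewrite /cst ?rmorph1 // mpolyCM rmorphM. Qed.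
HB.instance Definition _ :=
  GRing.isZmodMorphism.Build F (ratfun F) cst cst_is_zmod_morphism.
HB.instance Definition _ :=
  GRing.isMonoidMorphism.Build F (ratfun F) cst cst_is_monoid_morphism.

HB.instance Definition _ h := GRing.RMorphism.on (poly_subst h).

Lemma poly_substC h c : poly_subst h c%:MP = cst c.
Proof. exact: mmapC. Qed.

Lemma poly_substX h i : poly_subst h 'X_i = tnth h i.
Proof. by rewrite /poly_subst mmapX mmap1U. Qed.

(** Substituting [k] in the images [h] returns the generators. The relation [specializes] replaces
    [subst k], which at this stage is not known to be a morphism. *)
Definition left_inverse_subst k h :=
  forall i, specializes (poly_subst k) (tnth h i) ('X_i)%:F.

Lemma specializes_poly_subst k h p : left_inverse_subst k h ->
  specializes (poly_subst k) (poly_subst h p) p%:F.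
Proof.
move=> hk.
have HC c : specializes (poly_subst k) (cst c) (c%:MP)%:F.
  by rewrite -[X in specializes _ _ X](poly_substC k); apply: specializes_tofrac.
elim/mpolyind: p => [|c m p _ _ IHp].
  by have := HC 0; rewrite !rmorph0.
rewrite -mul_mpolyC !rmorphD; apply: specializesD => //; rewrite !rmorphM.
apply: specializesM => /=; first by rewrite poly_substC; apply: HC.
rewrite mpolyXE_id !rmorph_prod /=.
elim: (index_enum _) => [|i s IHs]; rewrite ?big_nil ?big_cons.
  exact: specializes1.
by apply: specializesM => //; rewrite !rmorphXn /= poly_substX; apply: specializesX.
Qed.

(** This is the algebraic independence of [h]: a polynomial p is recovered from [poly_subst h p] as
    its only specialization along [k]. *)
Lemma poly_subst_inj k h : left_inverse_subst k h -> injective (poly_subst h).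
Proof.
move=> hk p p' e; apply/eqP; rewrite -tofrac_eq; apply/eqP.
by apply: specializes_fun (specializes_poly_subst p hk) _; rewrite e;
  apply: specializes_poly_subst.
Qed.

Section SubstMorphism.

Variable h : 12.-tuple (ratfun F).
Hypothesis h_inj : injective (poly_subst h).

Lemma specializes_subst x : specializes (poly_subst h) x (subst h x).
Proof. exact: specializes_repr. Qed.

(** Any presentation of x whose denominator survives the substitution computes [subst h x], so the
    representative chosen in [subst] is immaterial. *)
Lemma subst_spec x y : specializes (poly_subst h) x y -> subst h x = y.
Proof. exact/specializes_fun/specializes_subst. Qed.

Lemma subst_zmod_morphism : zmod_morphism (subst h).
Proof. by move=> x y; apply/subst_spec/specializesB; apply: specializes_subst. Qed.

Lemma subst_monoid_morphism : monoid_morphism (subst h).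
Proof.
split=> [|x y]; apply: subst_spec; first exact: specializes1.
by apply: specializesM; apply: specializes_subst.
Qed.

Lemma subst_cst c : subst h (cst c) = cst c.
Proof.
apply: subst_spec; rewrite -[X in specializes _ _ X](poly_substC h).
exact: specializes_tofrac.
Qed.

Lemma subst_var (j : nat) : (j < 12)%N -> subst h (var j) = nth 0 h j.
Proof.
move=> lt_j; apply: subst_spec; rewrite -[X in nth _ _ X](inordK lt_j) -tnth_nth.
by rewrite -poly_substX; apply: specializes_tofrac.
Qed.

End SubstMorphism.

Definition mutually_inverse_subst (u v : ratfun F -> ratfun F) :=
  exists h k, [/\ u = subst h, v = subst k,
                  left_inverse_subst h k & left_inverse_subst k h].

Section MutuallyInverse.

Variables u v : ratfun F -> ratfun F.
Hypothesis uv : mutually_inverse_subst u v.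

Lemma inverse_subst_zmod_morphism : zmod_morphism u.
Proof.
case: uv => h [k [-> _ _ kh]]; apply: subst_zmod_morphism.
exact: poly_subst_inj kh.
Qed.

Lemma inverse_subst_monoid_morphism : monoid_morphism u.
Proof.
case: uv => h [k [-> _ _ kh]]; apply: subst_monoid_morphism.
exact: poly_subst_inj kh.
Qed.

Lemma inverse_subst_cst c : u (cst c) = cst c.
Proof.
case: uv => h [k [-> _ _ kh]]; apply: subst_cst.
exact: poly_subst_inj kh.
Qed.

(** Substituting [h] in the numerator and the denominator of [subst k x] returns those of [x]. *)
Lemma inverse_substK : cancel v u.
Proof.
case: uv => h [k [-> -> hk kh]] x.
apply: (subst_spec (poly_subst_inj kh)).
rewrite [X in specializes _ _ X]frac_repr; apply: specializes_div.
- exact: specializes_poly_subst.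
- exact: specializes_poly_subst.
by rewrite tofrac_eq0 denom_ratioP.
Qed.

End MutuallyInverse.

Lemma mutually_inverse_substC u v :
  mutually_inverse_subst u v -> mutually_inverse_subst v u.
Proof. by case=> h [k [? ? ? ?]]; exists k, h. Qed.

Lemma inverse_subst_bij u v : mutually_inverse_subst u v -> bijective u.
Proof.
move=> uv; exists v; last exact: inverse_substK.
exact/inverse_substK/mutually_inverse_substC.
Qed.

Lemma left_inverse_substP h k :
    (forall j, (j < 12)%N -> specializes (poly_subst k) (nth 0 h j)
       (nth 0 [:: nu 1; nu 2; nu 3; nu 4; nu 5; nu 6; nu 7; nu 8;
                  kappa1; kappa2; f; g] j)) ->
  left_inverse_subst k h.
Proof.
move=> H i; have -> : ('X_i)%:F = var i by rewrite /var inord_val.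
rewrite (tnth_nth 0); have := H i (ltn_ord i).
by case: i => i /=; do 12?[case: i => [|i] //].
Qed.

Lemma specializes_poly_var h j :
  (j < 12)%N -> specializes (poly_subst h) (var j) (nth 0 h j).
Proof.
move=> lt_j; rewrite -[X in nth _ _ X](inordK lt_j) -tnth_nth -poly_substX.
exact: specializes_tofrac.
Qed.

Lemma specializes_meval_var (e : seq F) j : (j < 12)%N ->
  specializes (meval (fun i : 'I_12 => nth 0 e i)) (var j) (nth 0 e j).
Proof.
move=> lt_j; rewrite -[X in nth _ _ X](inordK lt_j).
rewrite -(mevalXU (fun i : 'I_12 => nth 0 e i)).
exact: specializes_tofrac.
Qed.

Lemma var_neq0 j : var j != 0 :> ratfun F.
Proof. by rewrite tofrac_eq0 -msupp_eq0 msuppX. Qed.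

End Subst.

(** Lets the value be built first as an unknown, along the syntax of x, and be compared with the
    expected one afterwards. *)
Lemma specializes_eq (R : idomainType) (K : fieldType)
    (phi : {rmorphism R -> K}) x y z :
  specializes phi x y -> y = z -> specializes phi x z.
Proof. by move=> ? <-. Qed.

(** Recursion on the syntax of the expression; the goals left over are the nonvanishing of
    denominators. A hypothesis about a subexpression, such as [q], takes precedence and makes it an
    atom. *)
Ltac specialize_expr :=
  lazymatch goal with
  | H : specializes _ ?x _ |- specializes _ ?x _ => exact: H
  | |- specializes _ 1 _ => exact: specializes1
  | |- specializes _ (_ + - _) _ => eapply specializesB; specialize_expr
  | |- specializes _ (_ + _) _ => eapply specializesD; specialize_expr
  | |- specializes _ (- _) _ => eapply specializesN; specialize_expr
  | |- specializes _ (_ * _^-1) _ =>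
      eapply specializes_div; [specialize_expr | specialize_expr |]
  | |- specializes _ (_ * _) _ => eapply specializesM; specialize_expr
  | |- specializes _ (_ ^+ _) _ => eapply specializesX; specialize_expr
  | |- specializes _ _^-1 _ => eapply specializesV; [specialize_expr|]
  | |- specializes _ _ _ =>
      first [exact: specializes_poly_var | exact: specializes_meval_var]
  end.

(* Shows that a rational function is nonzero by evaluating it at the point e;
   coordinates 0 and 1 do the job in every characteristic. *)
Ltac neq0_at e :=
  apply: (@specializes_neq0 _ _ (meval (fun i : 'I_12 => nth 0 e i)));
  [specialize_expr
  | rewrite /= !(mul0r, mulr0, mul1r, mulr1, add0r, addr0, oppr0, oppr_eq0,
                 oner_neq0) //].

(** * Identities over an abstract field *)

(* The identities are not proved directly in ratfun F because field would
   normalize by unfolding the operations of this concrete field. *)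

Lemma divf_neq0 (K : fieldType) (x y : K) : x != 0 -> y != 0 -> x / y != 0.
Proof. by move=> x0 y0; rewrite mulf_neq0 ?invr_eq0. Qed.

Lemma divf_divK (K : fieldType) (x y : K) : x != 0 -> x / (x / y) = y.
Proof. by move=> x0; rewrite invf_div mulrC divfK. Qed.

(** * The Moebius action of s_4 on f *)

Section Mobius.

Variables (K : fieldType) (n1 n5 k1 k2 g : K).
Hypotheses (n1_neq0 : n1 != 0) (n5_neq0 : n5 != 0).
Hypotheses (k2_neq0 : k2 != 0) (n1n5k1 : n1 * n5 - k1 != 0).
Hypotheses (k1k2 : k1 - k2 != 0) (gn1 : g * n1 - 1 != 0).
Hypotheses (gn5 : g * k2 - n5 != 0).

Definition s4_num (n1 n5 k1 k2 f g : K) :=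
  - k2 * (n1 * n5 - k1) * f * g - n5 * (k1 - k2) * f + k1 * (n1 * n5 - k2).
Definition s4_den (n1 n5 k1 k2 f g : K) :=
  - (n1 * n5 - k2) * f * g + n1 * (k1 - k2) * g + (n1 * n5 - k1).

(** For an involution the second denominator must be the determinant of the Moebius map over the
    first one. Here the determinant of [s4_num] and [s4_den], linear in f, is -(k1 - k2)(n1 n5 -
    k1)(g n1 - 1)(g k2 - n5), and its factors are those assumed nonzero. *)
Lemma s4_den_s4 f : s4_den n1 n5 k1 k2 f g != 0 ->
  s4_den (k2 / n5) (k2 / n1) (k1 * k2 / (n1 * n5)) k2
    (s4_num n1 n5 k1 k2 f g / (n5 * s4_den n1 n5 k1 k2 f g)) g
  = - k2 * (k1 - k2) * (n1 * n5 - k1) * (g * n1 - 1) * (g * k2 - n5)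
    / (n1 * n5 ^+ 2 * s4_den n1 n5 k1 k2 f g).
Proof.
rewrite /s4_den /s4_num => D0.
by field; rewrite D0 n1_neq0 n5_neq0.
Qed.

Lemma s4_den_s4_neq0 f : s4_den n1 n5 k1 k2 f g != 0 ->
  s4_den (k2 / n5) (k2 / n1) (k1 * k2 / (n1 * n5)) k2
    (s4_num n1 n5 k1 k2 f g / (n5 * s4_den n1 n5 k1 k2 f g)) g != 0.
Proof.
move=> D0; rewrite s4_den_s4 // ?mulf_neq0 ?oppr_eq0 ?invr_eq0 ?mulf_neq0 //.
Qed.

Lemma s4_kappa1_s4 :
  k1 * k2 / (n1 * n5) * k2 / (k2 / n5 * (k2 / n1)) = k1.
Proof. by field; rewrite n1_neq0 n5_neq0 k2_neq0. Qed.

Lemma s4_num_s4 f : s4_den n1 n5 k1 k2 f g != 0 ->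
  s4_num (k2 / n5) (k2 / n1) (k1 * k2 / (n1 * n5)) k2
    (s4_num n1 n5 k1 k2 f g / (n5 * s4_den n1 n5 k1 k2 f g)) g
  / (k2 / n1 * s4_den (k2 / n5) (k2 / n1) (k1 * k2 / (n1 * n5)) k2
    (s4_num n1 n5 k1 k2 f g / (n5 * s4_den n1 n5 k1 k2 f g)) g) = f.
Proof.
move=> D0; rewrite s4_den_s4 //.
(* Moving the factored denominator to the right leaves [field] with the original denominators
   only. *)
apply: (canLR (mulfK _)).
  by rewrite ?mulf_neq0 ?oppr_eq0 ?invr_eq0 ?mulf_neq0.
move: D0; rewrite /s4_den /s4_num => D0.
by field; rewrite D0 n1_neq0 n5_neq0.
Qed.

(** Numerator and denominator of the new ratio share the factor -(n1 n5 - k1) k2 / (n5 [s4_den]).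
    Once it cancels, only g - 1/n1 and g - n5/k2 are gained. *)
Lemma s4_fg_ratio f : s4_den n1 n5 k1 k2 f g != 0 -> f * g - 1 != 0 ->
  let f' := s4_num n1 n5 k1 k2 f g / (n5 * s4_den n1 n5 k1 k2 f g) in
  (f' * g - (k1 * k2 / (n1 * n5)) / k2) / (f' * g - 1) =
  (f * g - k1 / k2) / (f * g - 1) * ((g - n1^-1) / (g - n5 / k2)).
Proof.
move=> D0 fg1 f'; rewrite /f' => {f'}.
have e1 : s4_num n1 n5 k1 k2 f g / (n5 * s4_den n1 n5 k1 k2 f g) * g - 1 =
  - (n1 * n5 - k1) * k2 * (g - n5 / k2) * (f * g - 1)
    / (n5 * s4_den n1 n5 k1 k2 f g).
  move: D0; rewrite /s4_den /s4_num => D0.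
  by field; rewrite D0 k2_neq0 n5_neq0.
have e2 : s4_num n1 n5 k1 k2 f g / (n5 * s4_den n1 n5 k1 k2 f g) * g
    - (k1 * k2 / (n1 * n5)) / k2 =
  - (n1 * n5 - k1) * k2 * (g - n1^-1) * (f * g - k1 / k2)
    / (n5 * s4_den n1 n5 k1 k2 f g).
  move: D0; rewrite /s4_den /s4_num => D0.
  by field; rewrite D0 n1_neq0 k2_neq0 n5_neq0.
rewrite e1 e2; move: (s4_den _ _ _ _ _ _) D0 => D D0.
by field; rewrite k2_neq0 gn5 n1_neq0 fg1 D0 n5_neq0 oppr_eq0 n1n5k1.
Qed.

End Mobius.

(** * Scaling identities for Xi and S_{E_7}[c] *)

Section Scaling.

(* r plays the role of q *)
Variables (K : fieldType) (k1 k2 r : K).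
Hypotheses (k1_neq0 : k1 != 0) (k2_neq0 : k2 != 0) (r_neq0 : r != 0).

(** With c = k1/(r k2), each n_i is multiplied by c and k1, k2 by c^2, so that k1^2 k2^2 and the
    product of the n_i both gain c^8. *)
Lemma scale_q (n1 n2 n3 n4 n5 n6 n7 n8 : K) :
  r = k1 ^+ 2 * k2 ^+ 2 / (n1 * n2 * n3 * n4 * n5 * n6 * n7 * n8) ->
  n1 != 0 -> n2 != 0 -> n3 != 0 -> n4 != 0 ->
  n5 != 0 -> n6 != 0 -> n7 != 0 -> n8 != 0 ->
  (k1 ^+ 3 / (r ^+ 2 * k2 ^+ 2)) ^+ 2 * (k1 ^+ 2 / (r ^+ 2 * k2)) ^+ 2 /
  (n1 * k1 / (r * k2) * (n2 * k1 / (r * k2)) *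
   (n3 * k1 / (r * k2)) * (n4 * k1 / (r * k2)) *
   (n5 * k1 / (r * k2)) * (n6 * k1 / (r * k2)) *
   (n7 * k1 / (r * k2)) * (n8 * k1 / (r * k2))) = r.
Proof.
move=> rE *; rewrite [RHS]rE; field.
by do ?[apply/andP; split].
Qed.

Lemma unscale_q (n1 n2 n3 n4 n5 n6 n7 n8 : K) :
  r = k1 ^+ 2 * k2 ^+ 2 / (n1 * n2 * n3 * n4 * n5 * n6 * n7 * n8) ->
  n1 != 0 -> n2 != 0 -> n3 != 0 -> n4 != 0 ->
  n5 != 0 -> n6 != 0 -> n7 != 0 -> n8 != 0 ->
  (r ^+ 2 * k2 ^+ 2 / k1) ^+ 2 * (r ^+ 2 * k2 ^+ 3 / k1 ^+ 2) ^+ 2 /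
  (n1 * r * k2 / k1 * (n2 * r * k2 / k1) *
   (n3 * r * k2 / k1) * (n4 * r * k2 / k1) *
   (n5 * r * k2 / k1) * (n6 * r * k2 / k1) *
   (n7 * r * k2 / k1) * (n8 * r * k2 / k1)) = r.
Proof.
move=> rE *; rewrite [RHS]rE; field.
by do ?[apply/andP; split].
Qed.

(** From here to [unscale_g], Xi is applied to the formulas of its inverse; [scale_nu] to [scale_g]
    treat the opposite composite. The weight of f is that of the nu_i. *)
Lemma unscale_nu (n : K) :
  n * k1 / (r * k2) * r * (k1 ^+ 2 / (r ^+ 2 * k2)) /
  (k1 ^+ 3 / (r ^+ 2 * k2 ^+ 2)) = n.
Proof. by field; rewrite k1_neq0 k2_neq0 r_neq0. Qed.

Lemma unscale_kappa1 :
  r ^+ 2 * (k1 ^+ 2 / (r ^+ 2 * k2)) ^+ 2 / (k1 ^+ 3 / (r ^+ 2 * k2 ^+ 2)) = k1.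
Proof. by field; rewrite k1_neq0 k2_neq0 r_neq0. Qed.

Lemma unscale_kappa2 :
  r ^+ 2 * (k1 ^+ 2 / (r ^+ 2 * k2)) ^+ 3 / (k1 ^+ 3 / (r ^+ 2 * k2 ^+ 2)) ^+ 2
  = k2.
Proof. by field; rewrite k1_neq0 k2_neq0 r_neq0. Qed.

Lemma unscale_g (y : K) :
  y * r * k2 / k1 * (k1 ^+ 3 / (r ^+ 2 * k2 ^+ 2)) /
  (r * (k1 ^+ 2 / (r ^+ 2 * k2))) = y.
Proof. by field; rewrite k1_neq0 k2_neq0 r_neq0. Qed.

Lemma scale_nu (n : K) :
  n * r * k2 / k1 * (r ^+ 2 * k2 ^+ 2 / k1) /
  (r * (r ^+ 2 * k2 ^+ 3 / k1 ^+ 2)) = n.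
Proof. by field; rewrite k1_neq0 k2_neq0 r_neq0. Qed.

Lemma scale_kappa1 :
  (r ^+ 2 * k2 ^+ 2 / k1) ^+ 3 / (r ^+ 2 * (r ^+ 2 * k2 ^+ 3 / k1 ^+ 2) ^+ 2)
  = k1.
Proof. by field; rewrite k1_neq0 k2_neq0 r_neq0. Qed.

Lemma scale_kappa2 :
  (r ^+ 2 * k2 ^+ 2 / k1) ^+ 2 / (r ^+ 2 * (r ^+ 2 * k2 ^+ 3 / k1 ^+ 2)) = k2.
Proof. by field; rewrite k1_neq0 k2_neq0 r_neq0. Qed.

Lemma scale_g (y : K) :
  y * k1 / (r * k2) * r * (r ^+ 2 * k2 ^+ 3 / k1 ^+ 2) /
  (r ^+ 2 * k2 ^+ 2 / k1) = y.
Proof. by field; rewrite k1_neq0 k2_neq0 r_neq0. Qed.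

Lemma SE7_q (d n1 n2 n3 n4 n5 n6 n7 n8 : K) :
  r = k1 ^+ 2 * k2 ^+ 2 / (n1 * n2 * n3 * n4 * n5 * n6 * n7 * n8) ->
  d != 0 -> n1 != 0 -> n2 != 0 -> n3 != 0 -> n4 != 0 ->
  n5 != 0 -> n6 != 0 -> n7 != 0 -> n8 != 0 ->
  k1 ^+ 2 * k2 ^+ 2 / (d * n1 * (d * n2) * (d * n3) * (d * n4) *
    (d^-1 * n5) * (d^-1 * n6) * (d^-1 * n7) * (d^-1 * n8)) = r.
Proof.
move=> rE *; rewrite rE; field.
by do ?[apply/andP; split].
Qed.

End Scaling.

(** * Evolution of the ratio (f g - k1/k2)/(f g - 1) *)

Section Evolution.

Variables (K : fieldType) (n1 n2 n3 n4 n5 n6 n7 n8 k1 k2 f g q : K).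

(** The equations are paired in [Type], so that one hypothesis serves [rewrite] as a whole family of
    rules. *)
Definition acts (s : K -> K) m1 m2 m3 m4 m5 m6 m7 m8 l1 l2 f' g' :=
  ((s n1 = m1) * (s n2 = m2) * (s n3 = m3) * (s n4 = m4) *
   (s n5 = m5) * (s n6 = m6) * (s n7 = m7) * (s n8 = m8) *
   (s k1 = l1) * (s k2 = l2) * (s f = f') * (s g = g'))%type.

Definition fg_ratio := (f * g - k1 / k2) / (f * g - 1).

Definition g_ratio :=
  (g - n1^-1) * (g - n2^-1) * (g - n3^-1) * (g - n4^-1)
  / ((g - n5 / k2) * (g - n6 / k2) * (g - n7 / k2) * (g - n8 / k2)).

(** The right-hand side of the second equation; [g_ratio] is the inverse of that of the first. *)
Definition f_ratio :=
  (f - k1 / n5) * (f - k1 / n6) * (f - k1 / n7) * (f - k1 / n8)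
  / ((f - n1) * (f - n2) * (f - n3) * (f - n4)).

Hypothesis qE :
  q = k1 ^+ 2 * k2 ^+ 2 / (n1 * n2 * n3 * n4 * n5 * n6 * n7 * n8).
Hypotheses (n1_neq0 : n1 != 0) (n2_neq0 : n2 != 0) (n3_neq0 : n3 != 0)
  (n4_neq0 : n4 != 0) (n5_neq0 : n5 != 0) (n6_neq0 : n6 != 0)
  (n7_neq0 : n7 != 0) (n8_neq0 : n8 != 0) (k1_neq0 : k1 != 0)
  (k2_neq0 : k2 != 0) (f_neq0 : f != 0) (g_neq0 : g != 0).
Hypotheses (gn1_neq0 : g * n1 - 1 != 0) (gn2_neq0 : g * n2 - 1 != 0)
  (gn3_neq0 : g * n3 - 1 != 0) (gn4_neq0 : g * n4 - 1 != 0)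
  (gn5_neq0 : g * k2 - n5 != 0) (gn6_neq0 : g * k2 - n6 != 0)
  (gn7_neq0 : g * k2 - n7 != 0) (gn8_neq0 : g * k2 - n8 != 0).
Hypotheses (fg_neq1 : f * g - 1 != 0) (fg_neqk : f * g * k2 - k1 != 0).

(** * Action of the half word *)

Section HalfEvolution.

Variables (s0 s1 s2 s3 s4 s5 s6 s7 h : {rmorphism K -> K}).
Let f4 := s4_num n1 n5 k1 k2 f g / (n5 * s4_den n1 n5 k1 k2 f g).
Hypothesis a0 : acts s0 n1 n2 n3 n4 n5 n6 n7 n8 k2 k1 (1 / g) (1 / f).
Hypothesis a1 : acts s1 n1 n2 n4 n3 n5 n6 n7 n8 k1 k2 f g.
Hypothesis a2 : acts s2 n1 n3 n2 n4 n5 n6 n7 n8 k1 k2 f g.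
Hypothesis a3 : acts s3 n2 n1 n3 n4 n5 n6 n7 n8 k1 k2 f g.
Hypothesis a4 :
  acts s4 (k2 / n5) n2 n3 n4 (k2 / n1) n6 n7 n8 (k1 * k2 / (n1 * n5)) k2 f4 g.
Hypothesis a5 : acts s5 n1 n2 n3 n4 n6 n5 n7 n8 k1 k2 f g.
Hypothesis a6 : acts s6 n1 n2 n3 n4 n5 n7 n6 n8 k1 k2 f g.
Hypothesis a7 : acts s7 n1 n2 n3 n4 n5 n6 n8 n7 k1 k2 f g.
Hypotheses (n1n5k1 : n1 * n5 - k1 != 0)
  (s4_den_neq0 : s4_den n1 n5 k1 k2 f g != 0).
Hypothesis hE : forall x, h x =
  s4 (s5 (s3 (s4 (s6 (s5 (s2 (s3 (s4 (s7 (s6 (s5 (s1 (s2 (s3 (s4 (s0 x)))))))))))))))).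

Let simpE := (fmorphV, rmorphM, rmorphB, rmorph1, a1, a2, a3, a4, a5, a6, a7).

(** The image of g stays implicit: since h(f) = 1/g, it yields T(f) = 1/Xi(h(g)), which is found
    later from [half_ratio]. *)
Lemma half_acts : acts h (k2 / n8) (k2 / n7) (k2 / n6) (k2 / n5)
  (k2 / n4) (k2 / n3) (k2 / n2) (k2 / n1) k2 (q * k2 ^+ 2 / k1) (1 / g) (h g).
Proof.
do !split; rewrite // hE a0 ?simpE // qE; field.
by rewrite n1_neq0 n2_neq0 n3_neq0 n4_neq0 n5_neq0 n6_neq0 n7_neq0 n8_neq0 k1_neq0.
Qed.

Lemma s4_ratio : s4 fg_ratio = fg_ratio * ((g - n1^-1) / (g - n5 / k2)).
Proof. by rewrite -s4_fg_ratio // /fg_ratio !simpE. Qed.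

Lemma s0_ratio : s0 fg_ratio = k2 / k1 * fg_ratio.
Proof.
rewrite /fg_ratio !(fmorphV, rmorphM, rmorphB, rmorph1, a0).
field; rewrite fg_neq1 k1_neq0 k2_neq0 g_neq0 f_neq0 /=.
(* The remaining denominator, from 1/(g f) - 1, is f g - 1 with the opposite sign. *)
by apply: contra_neq fg_neq1 => H; rewrite -[RHS]oppr0 -H; ring.
Qed.

Lemma si_ratio : (s1 fg_ratio = fg_ratio) * (s2 fg_ratio = fg_ratio) *
  (s3 fg_ratio = fg_ratio) * (s5 fg_ratio = fg_ratio) *
  (s6 fg_ratio = fg_ratio) * (s7 fg_ratio = fg_ratio).
Proof. by do !split; rewrite /fg_ratio !simpE. Qed.

(** In order of application, the four s_4 end up contributing (g - 1/nu_i)/(g - nu_(i+4)/kappa_2)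
    for i = 4, 3, 2, 1, because no factor is moved by a later s_4. The factor kappa_2/kappa_1 coming
    from s_0 is carried to kappa_1/(q kappa_2). *)
Lemma half_ratio : h fg_ratio = k1 / (q * k2) * fg_ratio * g_ratio.
Proof.
rewrite hE s0_ratio /g_ratio; move: s4_ratio si_ratio.
(* Abstracting Y keeps f out of the computation; only g and the parameters remain to be
   transformed. *)
move: fg_ratio => Y s4Y siY.
rewrite !(s4Y, siY, simpE) qE; field.
by rewrite n1_neq0 n2_neq0 n3_neq0 n4_neq0 n5_neq0 n6_neq0 n7_neq0 n8_neq0
  k1_neq0 k2_neq0 gn5_neq0 gn6_neq0 gn7_neq0 gn8_neq0.
Qed.

End HalfEvolution.

(** * The full evolution T and its two equations *)

Section FullEvolution.

Variables h X T : {rmorphism K -> K}.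
Hypothesis ah : acts h (k2 / n8) (k2 / n7) (k2 / n6) (k2 / n5)
  (k2 / n4) (k2 / n3) (k2 / n2) (k2 / n1) k2 (q * k2 ^+ 2 / k1) (1 / g) (h g).
Hypothesis h_ratio : h fg_ratio = k1 / (q * k2) * fg_ratio * g_ratio.
Hypothesis aX : acts X
  (n1 * k1 / (q * k2)) (n2 * k1 / (q * k2)) (n3 * k1 / (q * k2))
  (n4 * k1 / (q * k2)) (n5 * k1 / (q * k2)) (n6 * k1 / (q * k2))
  (n7 * k1 / (q * k2)) (n8 * k1 / (q * k2))
  (k1 ^+ 3 / (q ^+ 2 * k2 ^+ 2)) (k1 ^+ 2 / (q ^+ 2 * k2))
  (f * k1 / (q * k2)) (g * q * k2 / k1).
Hypothesis TE : forall x, T x = X (h (h x)).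

Lemma q_neq0 : q != 0.
Proof. by rewrite qE mulf_neq0 ?invr_eq0 ?mulf_neq0 ?expf_neq0. Qed.

Lemma X_q : X q = q.
Proof.
have q0 := q_neq0; rewrite {1}qE !(fmorphV, rmorphM, rmorphXn, aX) /=.
rewrite [RHS]qE; field.
by rewrite n1_neq0 n2_neq0 n3_neq0 n4_neq0 n5_neq0 n6_neq0 n7_neq0 n8_neq0
  k1_neq0 k2_neq0 q0.
Qed.

Lemma h_q : h q = q.
Proof.
have q0 := q_neq0; rewrite {1}qE !(fmorphV, rmorphM, rmorphXn, ah) /=.
rewrite qE; field.
by rewrite n1_neq0 n2_neq0 n3_neq0 n4_neq0 n5_neq0 n6_neq0 n7_neq0 n8_neq0
  k1_neq0 k2_neq0.
Qed.

Let simpE := (fmorphV, rmorphM, rmorphXn, rmorphB, rmorph1, h_q, X_q, ah, aX).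

(** Applying [h] twice divides each nu_i by c = k1/(q k2), and [X], which fixes c, multiplies it
    back. *)
Lemma T_acts : acts T n1 n2 n3 n4 n5 n6 n7 n8 (k1 / q) (q * k2) (T f) (T g).
Proof.
have q0 := q_neq0.
do !split; rewrite // TE !simpE //=; field;
by rewrite ?n1_neq0 ?n2_neq0 ?n3_neq0 ?n4_neq0 ?n5_neq0 ?n6_neq0 ?n7_neq0
  ?n8_neq0 ?k1_neq0 ?k2_neq0 ?q0.
Qed.

Lemma g_ratio_neq0 : g_ratio != 0.
Proof.
have sub_neq0 x y : y != 0 -> g * y - x != 0 -> g - x / y != 0.
  move=> y0 H; apply: contra_neq H => e.
  by rewrite -[g](subrK (x / y)) e add0r divfK ?subrr.
(* Writing the inverses as quotients lets [sub_neq0] treat all eight factors. *)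
rewrite /g_ratio -(div1r n1) -(div1r n2) -(div1r n3) -(div1r n4).
by rewrite !(mulf_neq0, invr_eq0, sub_neq0).
Qed.

Let c := k1 / (q * k2).

Lemma c_neq0 : c != 0.
Proof. by rewrite mulf_neq0 ?invr_eq0 ?mulf_neq0 ?q_neq0. Qed.

Lemma X_c : X c = c.
Proof.
have q0 := q_neq0; rewrite /c !simpE; field.
by rewrite k1_neq0 k2_neq0 q0.
Qed.

Lemma h_c : h c = c / q.
Proof.
have q0 := q_neq0; rewrite /c !simpE; field.
by rewrite k1_neq0 k2_neq0 q0.
Qed.

Lemma X_fg_ratio : X fg_ratio = fg_ratio.
Proof.
have q0 := q_neq0; rewrite /fg_ratio !simpE.
congr ((_ - _) / (_ - _)); field; by rewrite k1_neq0 k2_neq0 q0.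
Qed.

(** Each of the eight factors is divided by c, four above and four below. *)
Lemma X_g_ratio : X g_ratio = g_ratio.
Proof.
have c0 := c_neq0; have q0 := q_neq0.
have subV n : n != 0 -> X n = n * k1 / (q * k2) ->
    X (g - n^-1) = (g - n^-1) / c.
  move=> n0 Xn; rewrite rmorphB fmorphV Xn !simpE /c; field.
  by rewrite n0 k1_neq0 k2_neq0 q0.
have subk n : X n = n * k1 / (q * k2) -> X (g - n / k2) = (g - n / k2) / c.
  move=> Xn; rewrite rmorphB rmorphM fmorphV Xn !simpE /c; field.
  by rewrite k1_neq0 k2_neq0 q0.
rewrite /g_ratio fmorph_div !rmorphM !(subV, subk) ?aX //.
move: c0 (g - n1^-1) (g - n2^-1) (g - n3^-1) (g - n4^-1) => c0 x1 x2 x3 x4.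
have := g_ratio_neq0; rewrite /g_ratio mulf_eq0 invr_eq0 => /norP[_].
move: (g - n5 / k2) (g - n6 / k2) (g - n7 / k2) (g - n8 / k2) => y1 y2 y3 y4.
move: c c0 => d d0.
rewrite !mulf_eq0 !negb_or -!andbA => /and4P[y10 y20 y30 y40].
by field; rewrite d0 y10 y20 y30 y40.
Qed.

Lemma X_h_ratio : X (h fg_ratio) = c * fg_ratio * g_ratio.
Proof. by rewrite h_ratio -/c rmorphM (rmorphM X c) X_c X_fg_ratio X_g_ratio. Qed.

Lemma Tf_neq0 : T f != 0. Proof. by rewrite fmorph_eq0. Qed.

(** X(h(Y)) is computed twice. From h(k1/k2) = c and X(h(f g)) = c/(T(f) g) it is c (T(f) g -
    1)/(T(f) g - c); from [X_h_ratio] it is c Y G. *)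
Lemma T_f_ratio : (T f * g - 1) / (T f * g - c) = fg_ratio * g_ratio.
Proof.
have c0 := c_neq0; have q0 := q_neq0; have Tf0 := Tf_neq0.
have hk : h (k1 / k2) = c.
  by rewrite /c !simpE; field; rewrite ?k1_neq0 ?k2_neq0 ?q0.
have Xfg : X (h (f * g)) = c / (T f * g).
  rewrite rmorphM rmorphM TE !ah div1r !fmorphV aX !invfM !invrK /c.
  by field; rewrite g_neq0 k2_neq0 q0.
have := X_h_ratio; rewrite {1}/fg_ratio !(fmorph_div, rmorphB, rmorph1).
rewrite -(fmorph_div X) -(fmorph_div h) hk Xfg X_c => e.
apply: (mulfI c0); rewrite [RHS]mulrA -{}e [LHS]mulrA.
have -> : c / (T f * g) - c = c * (T f * g - 1) * - (T f * g)^-1.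
  by field; rewrite Tf0 g_neq0.
have -> : c / (T f * g) - 1 = (T f * g - c) * - (T f * g)^-1.
  by field; rewrite Tf0 g_neq0.
by rewrite -mulf_div divff ?mulr1 // oppr_eq0 invr_eq0 mulf_neq0.
Qed.

Lemma fg_ratio_neq0 : fg_ratio != 0.
Proof.
rewrite mulf_neq0 ?invr_eq0 //; apply: contra_neq fg_neqk => e.
by rewrite -(mul0r k2) -e mulrBl divfK.
Qed.

(** Multiplying the inverse of [T_f_ratio] by Y leaves 1/G. *)
Lemma T_f_equation :
  ((T f * g - k1 / (q * k2)) * (f * g - k1 / k2))
    / ((T f * g - 1) * (f * g - 1))
  = ((g - n5 / k2) * (g - n6 / k2) * (g - n7 / k2) * (g - n8 / k2))
    / ((g - 1 / n1) * (g - 1 / n2) * (g - 1 / n3) * (g - 1 / n4)).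
Proof.
have Y0 := fg_ratio_neq0; rewrite !div1r -[RHS]invf_div -/g_ratio.
by rewrite -mulf_div -invf_div T_f_ratio -/fg_ratio invfM mulrAC mulVf ?mul1r.
Qed.

(** As h(f) = 1/g and nu_i goes to k2/nu_(9-i), the factors of [f_ratio] become multiples of those
    of G. The constants multiply to nu_1 ... nu_8 / k2^4 = q c^2. *)
Lemma h_f_ratio : h f_ratio = q * c ^+ 2 * g_ratio.
Proof.
have q0 := q_neq0.
have hf n m : n != 0 -> h m = k2 / n -> h (f - k1 / m) = - (n / g) * (g - n^-1).
  move=> n0 hm; rewrite rmorphB fmorph_div hm ah ah; field.
  by rewrite n0 g_neq0 k2_neq0.
have hn n m : n != 0 -> h m = k2 / n -> h (f - m) = - (k2 / (n * g)) * (g - n / k2).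
  move=> n0 hm; rewrite rmorphB hm ah; field.
  by rewrite n0 g_neq0 k2_neq0.
rewrite /f_ratio fmorph_div !rmorphM.
rewrite (hf n4 n5) ?(hf n3 n6) ?(hf n2 n7) ?(hf n1 n8) ?ah //.
rewrite (hn n8 n1) ?(hn n7 n2) ?(hn n6 n3) ?(hn n5 n4) ?ah //.
have := g_ratio_neq0; rewrite /g_ratio mulf_eq0 invr_eq0 => /norP[_].
move: (g - n1^-1) (g - n2^-1) (g - n3^-1) (g - n4^-1) => x1 x2 x3 x4.
move: (g - n5 / k2) (g - n6 / k2) (g - n7 / k2) (g - n8 / k2) => y1 y2 y3 y4.
rewrite !mulf_eq0 !negb_or -!andbA => /and4P[y10 y20 y30 y40].
rewrite /c qE; field.
by rewrite oppr_eq0 y10 y20 y30 y40 n1_neq0 n2_neq0 n3_neq0 n4_neq0 n5_neq0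
  n6_neq0 n7_neq0 n8_neq0 k1_neq0 k2_neq0 g_neq0.
Qed.

(** Both sides equal (c^2/q) X(h(G)): on the left h(h(Y)) = h(c Y G) is used, on the right
    h(h([f_ratio])) = h(q c^2 G). The value h(G) stays unevaluated. *)
Lemma T_g_ratio :
  T fg_ratio * ((T f * g - c) / (T f * g - 1)) = T f_ratio.
Proof.
have c0 := c_neq0; have q0 := q_neq0; have Xq := X_q.
rewrite -[_ / _]invf_div T_f_ratio !TE h_f_ratio h_ratio -/c.
move: h_ratio h_c h_q X_c X_fg_ratio X_g_ratio fg_ratio_neq0 g_ratio_neq0.
rewrite -/c; move: fg_ratio g_ratio c c0 => Y G d d0 hY hd hq Xd XY XG Y0 G0.
rewrite !(rmorphM h) hY hd hq.
rewrite !(fmorphV, rmorphM, rmorphXn) /= XY XG Xd Xq.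
by field; rewrite Y0 G0 q0.
Qed.

Lemma T_q : T q = q.
Proof. by rewrite TE !h_q X_q. Qed.

(** The form with the inverse evolution, u standing for the underlined g. The injective [T] turns it
    into [T_g_ratio], since T(q k1/k2) = c. *)
Lemma fg_equation u : T u = g ->
  ((f * g - k1 / k2) * (f * u - q * k1 / k2)) / ((f * g - 1) * (f * u - 1))
  = f_ratio.
Proof.
move=> Tu; have q0 := q_neq0; apply: (fmorph_inj T); rewrite -T_g_ratio -mulf_div.
rewrite (rmorphM T fg_ratio) fmorph_div.
congr (_ * _); rewrite fmorph_div !(rmorphB, rmorphM, rmorph1) Tu fmorphV.
rewrite T_q !T_acts; congr ((_ - _) / _); rewrite /c.
by field; rewrite k2_neq0 q0.
Qed.

Lemma T_g_equation :
  ((T g * T f - k1 / (q ^+ 2 * k2)) * (T f * g - k1 / (q * k2)))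
    / ((T g * T f - 1) * (T f * g - 1))
  = ((T f - T (k1 / n5)) * (T f - T (k1 / n6))
     * (T f - T (k1 / n7)) * (T f - T (k1 / n8)))
    / ((T f - n1) * (T f - n2) * (T f - n3) * (T f - n4)).
Proof.
have q0 := q_neq0; have <- : T f_ratio =
    (T f - T (k1 / n5)) * (T f - T (k1 / n6))
     * (T f - T (k1 / n7)) * (T f - T (k1 / n8))
    / ((T f - n1) * (T f - n2) * (T f - n3) * (T f - n4)).
  rewrite /f_ratio fmorph_div !(rmorphM T _ (f - _)) !(rmorphB T f).
  by rewrite !T_acts.
rewrite -T_g_ratio -mulf_div [T g * T f]mulrC fmorph_div.
rewrite !(rmorphB, rmorphM, rmorph1) fmorphV !T_acts.
congr ((_ - _) / _ * _).
by field; rewrite k2_neq0 q0.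
Qed.

(** In [X] the nu_i have weight 1 and the kappas weight 2 in c, so nu_j/kappa_1 gets c^-1 and
    kappa_2/kappa_1 is fixed, as under [S]. *)
Lemma X_SE7 (S : {rmorphism K -> K}) :
    acts S (c * n1) (c * n2) (c * n3) (c * n4)
      (c^-1 * n5) (c^-1 * n6) (c^-1 * n7) (c^-1 * n8) k1 k2 (c * f) (c^-1 * g) ->
  let gens := [:: n1; n2; n3; n4; n5 / k1; n6 / k1; n7 / k1; n8 / k1;
                  k2 / k1; f; g] in
  map X gens = map S gens.
Proof.
have q0 := q_neq0.
move=> aS /=; rewrite !fmorph_div !aX !aS /c.
by congr [:: _; _; _; _; _; _; _; _; _; _; _]; field;
  rewrite ?k1_neq0 ?k2_neq0 ?q0.
Qed.

End FullEvolution.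
End Evolution.

(** * The transformations of the function field *)

(** Treats the twelve generators in turn; nonvanishing conditions and the equations that are not
    syntactic remain as goals. *)
Ltac left_inverse :=
  apply: left_inverse_substP; do 12?[case=> [_|] //];
  (eapply specializes_eq; [rewrite [nth _ _ _]/=; specialize_expr | ]);
  rewrite /=; try lazymatch goal with |- ?x = ?x => reflexivity end.

(* Otherwise a failing unification of two distinct generators, or of a
   generator with a compound expression, unfolds the fraction field. *)
Local Opaque var.

Section Generators.
Context {F : fieldType}.
Implicit Types (h k : 12.-tuple (ratfun F)).

Local Notation acts_on_gens := (acts (@nu F 1) (@nu F 2) (@nu F 3) (@nu F 4)
  (@nu F 5) (@nu F 6) (@nu F 7) (@nu F 8) (@kappa1 F) (@kappa2 F) (@f F) (@g F)).

Lemma subst_acts h k : left_inverse_subst k h ->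
  acts_on_gens (subst h) (nth 0 h 0) (nth 0 h 1) (nth 0 h 2) (nth 0 h 3)
    (nth 0 h 4) (nth 0 h 5) (nth 0 h 6) (nth 0 h 7) (nth 0 h 8) (nth 0 h 9)
    (nth 0 h 10) (nth 0 h 11).
Proof. by move=> kh; do !split; exact: (subst_var (poly_subst_inj kh)). Qed.

Lemma inverse_subst_acts h k :
    left_inverse_subst h k -> left_inverse_subst k h ->
  mutually_inverse_subst (subst h) (subst k) /\
  acts_on_gens (subst h) (nth 0 h 0) (nth 0 h 1) (nth 0 h 2) (nth 0 h 3)
    (nth 0 h 4) (nth 0 h 5) (nth 0 h 6) (nth 0 h 7) (nth 0 h 8) (nth 0 h 9)
    (nth 0 h 10) (nth 0 h 11).
Proof.
by move=> hk kh; split; [exists h, k | exact: subst_acts kh].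
Qed.

Lemma self_inverse_subst_acts h : left_inverse_subst h h ->
  mutually_inverse_subst (subst h) (subst h) /\
  acts_on_gens (subst h) (nth 0 h 0) (nth 0 h 1) (nth 0 h 2) (nth 0 h 3)
    (nth 0 h 4) (nth 0 h 5) (nth 0 h 6) (nth 0 h 7) (nth 0 h 8) (nth 0 h 9)
    (nth 0 h 10) (nth 0 h 11).
Proof. by move=> hh; exact: (inverse_subst_acts hh hh). Qed.

Lemma nu_neq0 i : nu i != 0 :> ratfun F. Proof. exact: var_neq0. Qed.

Lemma kappa1_neq0 : kappa1 != 0 :> ratfun F. Proof. exact: var_neq0. Qed.

Lemma kappa2_neq0 : kappa2 != 0 :> ratfun F. Proof. exact: var_neq0. Qed.

Lemma f_neq0 : f != 0 :> ratfun F. Proof. exact: var_neq0. Qed.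

Lemma g_neq0 : g != 0 :> ratfun F. Proof. exact: var_neq0. Qed.

(** * The s_i as invertible substitutions *)

Lemma s0P : mutually_inverse_subst (@s0 F) s0 /\
  acts_on_gens s0 (nu 1) (nu 2) (nu 3) (nu 4) (nu 5) (nu 6) (nu 7) (nu 8)
    kappa2 kappa1 (1 / g) (1 / f).
Proof.
rewrite /s0; apply: self_inverse_subst_acts; left_inverse.
- by rewrite div1r invr_eq0 f_neq0.
- by rewrite !div1r invrK.
- by rewrite div1r invr_eq0 g_neq0.
- by rewrite !div1r invrK.
Qed.

Lemma s1P : mutually_inverse_subst (@s1 F) s1 /\
  acts_on_gens s1 (nu 1) (nu 2) (nu 4) (nu 3) (nu 5) (nu 6) (nu 7) (nu 8)
    kappa1 kappa2 f g.
Proof. rewrite /s1; apply: self_inverse_subst_acts; left_inverse. Qed.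

Lemma s2P : mutually_inverse_subst (@s2 F) s2 /\
  acts_on_gens s2 (nu 1) (nu 3) (nu 2) (nu 4) (nu 5) (nu 6) (nu 7) (nu 8)
    kappa1 kappa2 f g.
Proof. rewrite /s2; apply: self_inverse_subst_acts; left_inverse. Qed.

Lemma s3P : mutually_inverse_subst (@s3 F) s3 /\
  acts_on_gens s3 (nu 2) (nu 1) (nu 3) (nu 4) (nu 5) (nu 6) (nu 7) (nu 8)
    kappa1 kappa2 f g.
Proof. rewrite /s3; apply: self_inverse_subst_acts; left_inverse. Qed.

Lemma s5P : mutually_inverse_subst (@s5 F) s5 /\
  acts_on_gens s5 (nu 1) (nu 2) (nu 3) (nu 4) (nu 6) (nu 5) (nu 7) (nu 8)
    kappa1 kappa2 f g.
Proof. rewrite /s5; apply: self_inverse_subst_acts; left_inverse. Qed.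

Lemma s6P : mutually_inverse_subst (@s6 F) s6 /\
  acts_on_gens s6 (nu 1) (nu 2) (nu 3) (nu 4) (nu 5) (nu 7) (nu 6) (nu 8)
    kappa1 kappa2 f g.
Proof. rewrite /s6; apply: self_inverse_subst_acts; left_inverse. Qed.

Lemma s7P : mutually_inverse_subst (@s7 F) s7 /\
  acts_on_gens s7 (nu 1) (nu 2) (nu 3) (nu 4) (nu 5) (nu 6) (nu 8) (nu 7)
    kappa1 kappa2 f g.
Proof. rewrite /s7; apply: self_inverse_subst_acts; left_inverse. Qed.

(** * Nonvanishing by evaluation at points, and s_4 *)

Lemma s4_den_neq0 :
  s4_den (nu 1) (nu 5) kappa1 kappa2 f g != 0 :> ratfun F.
Proof.
rewrite /s4_den.
(* At nu_1 = nu_5 = 1 and zero elsewhere only nu_1 nu_5 survives. *)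
by neq0_at ([:: 1; 0; 0; 0; 1; 0; 0; 0; 0; 0; 0; 0] : seq F).
Qed.

Lemma nu1nu5_kappa1_neq0 : nu 1 * nu 5 - kappa1 != 0 :> ratfun F.
Proof. by neq0_at ([:: 0; 0; 0; 0; 0; 0; 0; 0; 1; 0; 0; 0] : seq F). Qed.

Lemma kappa1_kappa2_neq0 : kappa1 - kappa2 != 0 :> ratfun F.
Proof. by neq0_at ([:: 0; 0; 0; 0; 0; 0; 0; 0; 1; 0; 0; 0] : seq F). Qed.

Lemma fg_neq1 : f * g - 1 != 0 :> ratfun F.
Proof. by neq0_at ([:: 0; 0; 0; 0; 0; 0; 0; 0; 0; 0; 0; 0] : seq F). Qed.

Lemma fg_kappa_neq0 : f * g * kappa2 - kappa1 != 0 :> ratfun F.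
Proof. by neq0_at ([:: 0; 0; 0; 0; 0; 0; 0; 0; 1; 0; 0; 0] : seq F). Qed.

Lemma g_nu_neq0 i : (i <= 8)%N -> g * nu i - 1 != 0 :> ratfun F.
Proof.
(* There are nine cases: i = 0 is included, [nu 0] being [var 0] like [nu 1]. *)
by do 9?[case: i => [_|i] //];
  neq0_at ([:: 0; 0; 0; 0; 0; 0; 0; 0; 0; 0; 0; 0] : seq F).
Qed.

Lemma g_kappa2_nu_neq0 i : (i <= 8)%N -> g * kappa2 - nu i != 0 :> ratfun F.
Proof.
by do 9?[case: i => [_|i] //];
  neq0_at ([:: 1; 1; 1; 1; 1; 1; 1; 1; 0; 0; 0; 0] : seq F).
Qed.

Lemma s4P : mutually_inverse_subst (@s4 F) s4 /\
  acts_on_gens s4 (kappa2 / nu 5) (nu 2) (nu 3) (nu 4) (kappa2 / nu 1)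
    (nu 6) (nu 7) (nu 8) (kappa1 * kappa2 / (nu 1 * nu 5)) kappa2
    (s4_num (nu 1) (nu 5) kappa1 kappa2 f g
     / (nu 5 * s4_den (nu 1) (nu 5) kappa1 kappa2 f g)) g.
Proof.
rewrite /s4; apply: self_inverse_subst_acts; left_inverse.
(* For nu_1, nu_5, kappa_1 and f in turn: the denominator after a second s_4 is nonzero, then the
   generator is recovered. *)
- exact: divf_neq0 kappa2_neq0 (nu_neq0 1).
- exact: divf_divK kappa2_neq0.
- exact: divf_neq0 kappa2_neq0 (nu_neq0 5).
- exact: divf_divK kappa2_neq0.
- apply: mulf_neq0; first exact: divf_neq0 kappa2_neq0 (nu_neq0 5).
  exact: divf_neq0 kappa2_neq0 (nu_neq0 1).
- exact: s4_kappa1_s4 (nu_neq0 1) (nu_neq0 5) kappa2_neq0.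
- apply: mulf_neq0; first exact: divf_neq0 kappa2_neq0 (nu_neq0 1).
  exact: (s4_den_s4_neq0 (nu_neq0 1) (nu_neq0 5) kappa2_neq0
    nu1nu5_kappa1_neq0 kappa1_kappa2_neq0 (g_nu_neq0 (isT : 1 <= 8)%N)
    (g_kappa2_nu_neq0 (isT : 5 <= 8)%N) s4_den_neq0).
exact: (s4_num_s4 (nu_neq0 1) (nu_neq0 5) kappa2_neq0
    nu1nu5_kappa1_neq0 kappa1_kappa2_neq0 (g_nu_neq0 (isT : 1 <= 8)%N)
    (g_kappa2_nu_neq0 (isT : 5 <= 8)%N) s4_den_neq0).
Qed.

(** * The scaling Xi and its inverse *)

Lemma qE : q = kappa1 ^+ 2 * kappa2 ^+ 2 /
  (nu 1 * nu 2 * nu 3 * nu 4 * nu 5 * nu 6 * nu 7 * nu 8) :> ratfun F.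
Proof. by rewrite /q /index_iota /= !big_cons big_nil mulr1 !mulrA. Qed.

Lemma ratfun_q_neq0 : q != 0 :> ratfun F.
Proof.
exact: (q_neq0 qE (nu_neq0 1) (nu_neq0 2) (nu_neq0 3) (nu_neq0 4) (nu_neq0 5)
  (nu_neq0 6) (nu_neq0 7) (nu_neq0 8) kappa1_neq0 kappa2_neq0).
Qed.

(* constr_eq keeps the search for a hypothesis from comparing expressions up to
   conversion. *)
Ltac monomial_neq0 :=
  lazymatch goal with
  | |- is_true (_ * _ != 0) => apply: mulf_neq0; monomial_neq0
  | |- is_true (_ ^+ _ != 0) => apply: expf_neq0; monomial_neq0
  | |- is_true (_^-1 != 0) => rewrite invr_eq0; monomial_neq0
  | |- is_true (?x != 0) =>
    match goal with
    | H : forall i, is_true (?n i != 0) |- _ =>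
      lazymatch x with ?m ?i => constr_eq m n; exact (H i) end
    | H : is_true (?y != 0) |- _ => constr_eq x y; exact H
    end
  end.
Ltac ratfun_neq0 :=
  move: nu_neq0 kappa1_neq0 kappa2_neq0 ratfun_q_neq0
    f_neq0 g_neq0;
  move: (@nu F) (@kappa1 F) (@kappa2 F) (@q F) (@f F) (@g F)
    => ? ? ? ? ? ? ? ? ? ? ? ?; monomial_neq0.

Definition Xi_images : 12.-tuple (ratfun F) :=
         [tuple nu 1 * kappa1 / (q * kappa2); nu 2 * kappa1 / (q * kappa2);
               nu 3 * kappa1 / (q * kappa2); nu 4 * kappa1 / (q * kappa2);
               nu 5 * kappa1 / (q * kappa2); nu 6 * kappa1 / (q * kappa2);
               nu 7 * kappa1 / (q * kappa2); nu 8 * kappa1 / (q * kappa2);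
               kappa1 ^+ 3 / (q ^+ 2 * kappa2 ^+ 2);
               kappa1 ^+ 2 / (q ^+ 2 * kappa2);
               f * kappa1 / (q * kappa2); g * q * kappa2 / kappa1].
(** The weights of Xi with c = kappa_1/(q kappa_2) replaced by 1/c; this inverts Xi because c is
    fixed. *)
Definition Xi_inverse : 12.-tuple (ratfun F) :=
         [tuple nu 1 * q * kappa2 / kappa1; nu 2 * q * kappa2 / kappa1;
               nu 3 * q * kappa2 / kappa1; nu 4 * q * kappa2 / kappa1;
               nu 5 * q * kappa2 / kappa1; nu 6 * q * kappa2 / kappa1;
               nu 7 * q * kappa2 / kappa1; nu 8 * q * kappa2 / kappa1;
               q ^+ 2 * kappa2 ^+ 2 / kappa1;
               q ^+ 2 * kappa2 ^+ 3 / kappa1 ^+ 2;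
               f * q * kappa2 / kappa1; g * kappa1 / (q * kappa2)].

(** Once in the context, this lets [specialize_expr] treat q as a fixed atom. *)
Lemma Xi_images_q : specializes (poly_subst Xi_images) q q.
Proof.
rewrite {1}qE; eapply specializes_eq; first specialize_expr; rewrite /Xi_images /=.
  ratfun_neq0.
exact: (scale_q kappa1_neq0 kappa2_neq0 ratfun_q_neq0 qE (nu_neq0 1)
  (nu_neq0 2) (nu_neq0 3) (nu_neq0 4) (nu_neq0 5) (nu_neq0 6) (nu_neq0 7)
  (nu_neq0 8)).
Qed.

Lemma Xi_inverse_q : specializes (poly_subst Xi_inverse) q q.
Proof.
rewrite {1}qE; eapply specializes_eq; first specialize_expr; rewrite /Xi_inverse /=.
  ratfun_neq0.
exact: (unscale_q kappa1_neq0 kappa2_neq0 ratfun_q_neq0 qE (nu_neq0 1)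
  (nu_neq0 2) (nu_neq0 3) (nu_neq0 4) (nu_neq0 5) (nu_neq0 6) (nu_neq0 7)
  (nu_neq0 8)).
Qed.

Lemma XiP : mutually_inverse_subst (@Xi F) (subst Xi_inverse) /\
  acts_on_gens Xi
   (nu 1 * kappa1 / (q * kappa2)) (nu 2 * kappa1 / (q * kappa2))
               (nu 3 * kappa1 / (q * kappa2)) (nu 4 * kappa1 / (q * kappa2))
               (nu 5 * kappa1 / (q * kappa2)) (nu 6 * kappa1 / (q * kappa2))
               (nu 7 * kappa1 / (q * kappa2)) (nu 8 * kappa1 / (q * kappa2))
               (kappa1 ^+ 3 / (q ^+ 2 * kappa2 ^+ 2))
               (kappa1 ^+ 2 / (q ^+ 2 * kappa2))
               (f * kappa1 / (q * kappa2)) (g * q * kappa2 / kappa1).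
Proof.
have k10 := kappa1_neq0; have k20 := kappa2_neq0.
have q0 := ratfun_q_neq0.
apply: (@inverse_subst_acts Xi_images Xi_inverse).
  have := Xi_images_q; rewrite /Xi_images /Xi_inverse => Hq; left_inverse;
  lazymatch goal with |- is_true (_ != 0) => ratfun_neq0 | |- _ => idtac end.
  (* The goals for the nu_i and for f, which have the same weight. *)
  1-8, 11: exact: (unscale_nu k10 k20 q0).
  - exact: (unscale_kappa1 k10 k20 q0).
  - exact: (unscale_kappa2 k10 k20 q0).
  - exact: (unscale_g k10 k20 q0).
have := Xi_inverse_q; rewrite /Xi_images /Xi_inverse => Hq; left_inverse;
lazymatch goal with |- is_true (_ != 0) => ratfun_neq0 | |- _ => idtac end.
1-8, 11: exact: (scale_nu k10 k20 q0).
- exact: (scale_kappa1 k10 k20 q0).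
- exact: (scale_kappa2 k10 k20 q0).
- exact: (scale_g k10 k20 q0).
Qed.

(** * The transformation S_{E_7}[c] *)

Definition SE7_images (c : ratfun F) : 12.-tuple (ratfun F) :=
  [tuple c * nu 1; c * nu 2; c * nu 3; c * nu 4;
               c^-1 * nu 5; c^-1 * nu 6; c^-1 * nu 7; c^-1 * nu 8;
               kappa1; kappa2; c * f; c^-1 * g].

Lemma SE7_images_q c : c != 0 -> specializes (poly_subst (SE7_images c)) q q.
Proof.
move=> c0; rewrite {1}qE; eapply specializes_eq; first specialize_expr;
  rewrite /SE7_images /=.
  ratfun_neq0.
exact: (SE7_q qE c0 (nu_neq0 1)
  (nu_neq0 2) (nu_neq0 3) (nu_neq0 4) (nu_neq0 5) (nu_neq0 6) (nu_neq0 7)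
  (nu_neq0 8)).
Qed.

(** The factor c is itself a rational function on which the substitution acts, so its inverse must
    be known to be fixed. *)
Lemma SE7_left_inverse c : c != 0 ->
    specializes (poly_subst (SE7_images c)) c^-1 c^-1 ->
  left_inverse_subst (SE7_images c) (SE7_images c^-1).
Proof.
move=> c0 Hc; have cV0 := invr_neq0 c0; move: Hc; rewrite /SE7_images => Hc.
left_inverse; try lazymatch goal with |- is_true (_ != 0) => exact: cV0 end.
1-4, 9: exact: (mulKf c0).
all: exact: (mulKf cV0).
Qed.

Let c : ratfun F := kappa1 / (q * kappa2).

Lemma SE7P : mutually_inverse_subst (SE7 c) (SE7 c^-1) /\
  acts_on_gens (SE7 c) (c * nu 1) (c * nu 2) (c * nu 3) (c * nu 4)
    (c^-1 * nu 5) (c^-1 * nu 6) (c^-1 * nu 7) (c^-1 * nu 8)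
    kappa1 kappa2 (c * f) (c^-1 * g).
Proof.
have k10 := kappa1_neq0; have k20 := kappa2_neq0.
have q0 := ratfun_q_neq0.
have c0 : c != 0 by exact: divf_neq0 k10 (mulf_neq0 q0 k20).
have cV0 := invr_neq0 c0.
(* S_{E_7}[d] fixes kappa_1, kappa_2 and q, hence c. *)
have H d : d != 0 -> specializes (poly_subst (SE7_images d)) c c.
  move=> /SE7_images_q Hq; rewrite /c; eapply specializes_eq; first specialize_expr.
  - exact: mulf_neq0 q0 k20.
  - reflexivity.
apply: (@inverse_subst_acts (SE7_images c) (SE7_images c^-1)).
  exact: (SE7_left_inverse c0 (specializesV (H _ c0) c0)).
(* The other composite is the same statement for c^-1. *)
rewrite -{2}[c]invrK; apply: (SE7_left_inverse cV0); rewrite invrK.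
exact: (H _ cV0).
Qed.

(** * Morphism structures on the transformations and on T *)

Definition SE7_Xi : ratfun F -> ratfun F := SE7 c.
HB.instance Definition _ := GRing.isZmodMorphism.Build (ratfun F) (ratfun F)
  SE7_Xi (inverse_subst_zmod_morphism SE7P.1).
HB.instance Definition _ := GRing.isMonoidMorphism.Build (ratfun F) (ratfun F)
  SE7_Xi (inverse_subst_monoid_morphism SE7P.1).

HB.instance Definition _ := GRing.isZmodMorphism.Build (ratfun F) (ratfun F) s0
  (inverse_subst_zmod_morphism s0P.1).
HB.instance Definition _ := GRing.isMonoidMorphism.Build (ratfun F) (ratfun F)
  s0 (inverse_subst_monoid_morphism s0P.1).

HB.instance Definition _ := GRing.isZmodMorphism.Build (ratfun F) (ratfun F) s1
  (inverse_subst_zmod_morphism s1P.1).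
HB.instance Definition _ := GRing.isMonoidMorphism.Build (ratfun F) (ratfun F)
  s1 (inverse_subst_monoid_morphism s1P.1).

HB.instance Definition _ := GRing.isZmodMorphism.Build (ratfun F) (ratfun F) s2
  (inverse_subst_zmod_morphism s2P.1).
HB.instance Definition _ := GRing.isMonoidMorphism.Build (ratfun F) (ratfun F)
  s2 (inverse_subst_monoid_morphism s2P.1).

HB.instance Definition _ := GRing.isZmodMorphism.Build (ratfun F) (ratfun F) s3
  (inverse_subst_zmod_morphism s3P.1).
HB.instance Definition _ := GRing.isMonoidMorphism.Build (ratfun F) (ratfun F)
  s3 (inverse_subst_monoid_morphism s3P.1).

HB.instance Definition _ := GRing.isZmodMorphism.Build (ratfun F) (ratfun F) s4
  (inverse_subst_zmod_morphism s4P.1).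
HB.instance Definition _ := GRing.isMonoidMorphism.Build (ratfun F) (ratfun F)
  s4 (inverse_subst_monoid_morphism s4P.1).

HB.instance Definition _ := GRing.isZmodMorphism.Build (ratfun F) (ratfun F) s5
  (inverse_subst_zmod_morphism s5P.1).
HB.instance Definition _ := GRing.isMonoidMorphism.Build (ratfun F) (ratfun F)
  s5 (inverse_subst_monoid_morphism s5P.1).

HB.instance Definition _ := GRing.isZmodMorphism.Build (ratfun F) (ratfun F) s6
  (inverse_subst_zmod_morphism s6P.1).
HB.instance Definition _ := GRing.isMonoidMorphism.Build (ratfun F) (ratfun F)
  s6 (inverse_subst_monoid_morphism s6P.1).

HB.instance Definition _ := GRing.isZmodMorphism.Build (ratfun F) (ratfun F) s7
  (inverse_subst_zmod_morphism s7P.1).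
HB.instance Definition _ := GRing.isMonoidMorphism.Build (ratfun F) (ratfun F)
  s7 (inverse_subst_monoid_morphism s7P.1).

HB.instance Definition _ := GRing.isZmodMorphism.Build (ratfun F) (ratfun F) Xi
  (inverse_subst_zmod_morphism XiP.1).
HB.instance Definition _ := GRing.isMonoidMorphism.Build (ratfun F) (ratfun F)
  Xi (inverse_subst_monoid_morphism XiP.1).

Lemma comp_zmod_morphism (u v : ratfun F -> ratfun F) :
  zmod_morphism u -> zmod_morphism v -> zmod_morphism (u \o v).
Proof. by move=> hu hv x y; rewrite /= hv hu. Qed.

Lemma comp_monoid_morphism (u v : ratfun F -> ratfun F) :
  monoid_morphism u -> monoid_morphism v -> monoid_morphism (u \o v).
Proof.
by move=> [u1 uM] [v1 vM]; split=> [|x y]; rewrite /= ?v1 ?u1 ?vM ?uM.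
Qed.

Lemma rmorph_monoid_morphism (u : {rmorphism ratfun F -> ratfun F}) :
  monoid_morphism u.
Proof. by split; [exact: rmorph1 | exact: rmorphM]. Qed.

Lemma half_T_zmod_morphism : zmod_morphism (@half_T F).
Proof. by do 16?[apply: comp_zmod_morphism]; exact: raddfB. Qed.

Lemma half_T_monoid_morphism : monoid_morphism (@half_T F).
Proof. by do 16?[apply: comp_monoid_morphism]; exact: rmorph_monoid_morphism. Qed.
HB.instance Definition _ := GRing.isZmodMorphism.Build (ratfun F) (ratfun F)
  half_T half_T_zmod_morphism.
HB.instance Definition _ := GRing.isMonoidMorphism.Build (ratfun F) (ratfun F)
  half_T half_T_monoid_morphism.

Lemma T_zmod_morphism : zmod_morphism (@T F).
Proof. exact: (comp_zmod_morphism (raddfB Xi)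
  (comp_zmod_morphism half_T_zmod_morphism half_T_zmod_morphism)). Qed.

Lemma T_monoid_morphism : monoid_morphism (@T F).
Proof. exact: (comp_monoid_morphism (rmorph_monoid_morphism Xi)
  (comp_monoid_morphism half_T_monoid_morphism half_T_monoid_morphism)). Qed.
HB.instance Definition _ := GRing.isZmodMorphism.Build (ratfun F) (ratfun F)
  T T_zmod_morphism.
HB.instance Definition _ := GRing.isMonoidMorphism.Build (ratfun F) (ratfun F)
  T T_monoid_morphism.

(** * Transfer of the abstract identities to the function field *)

Lemma half_T_acts : acts_on_gens half_T
  (kappa2 / nu 8) (kappa2 / nu 7) (kappa2 / nu 6) (kappa2 / nu 5)
  (kappa2 / nu 4) (kappa2 / nu 3) (kappa2 / nu 2) (kappa2 / nu 1)
  kappa2 (q * kappa2 ^+ 2 / kappa1) (1 / g) (half_T g).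
Proof.
exact: (half_acts qE (nu_neq0 1) (nu_neq0 2) (nu_neq0 3)
  (nu_neq0 4) (nu_neq0 5) (nu_neq0 6) (nu_neq0 7) (nu_neq0 8)
  kappa1_neq0 s0P.2 s1P.2 s2P.2 s3P.2 s4P.2 s5P.2 s6P.2 s7P.2
  (fun x => erefl (half_T x))).
Qed.

Lemma half_T_ratio : half_T (fg_ratio kappa1 kappa2 f g) =
  kappa1 / (q * kappa2) * fg_ratio kappa1 kappa2 f g *
  g_ratio (nu 1) (nu 2) (nu 3) (nu 4) (nu 5) (nu 6) (nu 7) (nu 8) kappa2 g
  :> ratfun F.
Proof.
exact: (half_ratio qE (nu_neq0 1) (nu_neq0 2) (nu_neq0 3)
  (nu_neq0 4) (nu_neq0 5) (nu_neq0 6) (nu_neq0 7) (nu_neq0 8)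
  kappa1_neq0 kappa2_neq0 f_neq0 g_neq0
  (g_kappa2_nu_neq0 (isT : 5 <= 8)%N) (g_kappa2_nu_neq0 (isT : 6 <= 8)%N)
  (g_kappa2_nu_neq0 (isT : 7 <= 8)%N) (g_kappa2_nu_neq0 (isT : 8 <= 8)%N) fg_neq1
  s0P.2 s1P.2 s2P.2 s3P.2 s4P.2 s5P.2 s6P.2 s7P.2 nu1nu5_kappa1_neq0 s4_den_neq0
  (fun x => erefl (half_T x))).
Qed.

Local Notation endo := {rmorphism ratfun F -> ratfun F}.

(* The detour through variables keeps conversion from unfolding T down to subst
   before the coercions from endo are reduced. *)
Lemma T_comp x : (T : endo) x = (Xi : endo) ((half_T : endo) ((half_T : endo) x)).
Proof.
have TE (X h u : endo) : X = Xi -> h = half_T -> u = T ->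
    forall y, u y = X (h (h y)) by move=> -> -> -> y.
exact: TE.
Qed.

Lemma T_ratfun_acts : acts_on_gens T (nu 1) (nu 2) (nu 3) (nu 4) (nu 5) (nu 6)
  (nu 7) (nu 8) (kappa1 / q) (q * kappa2) (T f) (T g).
Proof.
exact: (T_acts qE (nu_neq0 1) (nu_neq0 2) (nu_neq0 3)
  (nu_neq0 4) (nu_neq0 5) (nu_neq0 6) (nu_neq0 7) (nu_neq0 8)
  kappa1_neq0 kappa2_neq0 half_T_acts XiP.2
  T_comp).
Qed.

Lemma T_ratfun_f_equation :
  ((T f * g - kappa1 / (q * kappa2)) * (f * g - kappa1 / kappa2))
    / ((T f * g - 1) * (f * g - 1))
  = ((g - nu 5 / kappa2) * (g - nu 6 / kappa2)
     * (g - nu 7 / kappa2) * (g - nu 8 / kappa2))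
    / ((g - 1 / nu 1) * (g - 1 / nu 2) * (g - 1 / nu 3) * (g - 1 / nu 4))
  :> ratfun F.
Proof.
exact: (T_f_equation qE (nu_neq0 1) (nu_neq0 2) (nu_neq0 3)
  (nu_neq0 4) (nu_neq0 5) (nu_neq0 6) (nu_neq0 7) (nu_neq0 8)
  kappa1_neq0 kappa2_neq0 f_neq0 g_neq0
  (g_nu_neq0 (isT : 1 <= 8)%N) (g_nu_neq0 (isT : 2 <= 8)%N)
  (g_nu_neq0 (isT : 3 <= 8)%N) (g_nu_neq0 (isT : 4 <= 8)%N)
  (g_kappa2_nu_neq0 (isT : 5 <= 8)%N) (g_kappa2_nu_neq0 (isT : 6 <= 8)%N)
  (g_kappa2_nu_neq0 (isT : 7 <= 8)%N) (g_kappa2_nu_neq0 (isT : 8 <= 8)%N)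
  fg_neq1 fg_kappa_neq0
  half_T_acts half_T_ratio XiP.2 T_comp).
Qed.

Lemma T_ratfun_g_equation :
  ((T g * T f - kappa1 / (q ^+ 2 * kappa2)) * (T f * g - kappa1 / (q * kappa2)))
    / ((T g * T f - 1) * (T f * g - 1))
  = ((T f - T (kappa1 / nu 5)) * (T f - T (kappa1 / nu 6))
     * (T f - T (kappa1 / nu 7)) * (T f - T (kappa1 / nu 8)))
    / ((T f - nu 1) * (T f - nu 2) * (T f - nu 3) * (T f - nu 4)) :> ratfun F.
Proof.
exact: (T_g_equation qE (nu_neq0 1) (nu_neq0 2) (nu_neq0 3)
  (nu_neq0 4) (nu_neq0 5) (nu_neq0 6) (nu_neq0 7) (nu_neq0 8)
  kappa1_neq0 kappa2_neq0 f_neq0 g_neq0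
  (g_nu_neq0 (isT : 1 <= 8)%N) (g_nu_neq0 (isT : 2 <= 8)%N)
  (g_nu_neq0 (isT : 3 <= 8)%N) (g_nu_neq0 (isT : 4 <= 8)%N)
  (g_kappa2_nu_neq0 (isT : 5 <= 8)%N) (g_kappa2_nu_neq0 (isT : 6 <= 8)%N)
  (g_kappa2_nu_neq0 (isT : 7 <= 8)%N) (g_kappa2_nu_neq0 (isT : 8 <= 8)%N)
  fg_neq1 fg_kappa_neq0
  half_T_acts half_T_ratio XiP.2 T_comp).
Qed.

Lemma ratfun_fg_equation (u : ratfun F) : T u = g ->
  ((f * g - kappa1 / kappa2) * (f * u - q * kappa1 / kappa2))
    / ((f * g - 1) * (f * u - 1))
  = f_ratio (nu 1) (nu 2) (nu 3) (nu 4) (nu 5) (nu 6) (nu 7) (nu 8) kappa1 f.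
Proof.
exact: (fg_equation qE (nu_neq0 1) (nu_neq0 2) (nu_neq0 3)
  (nu_neq0 4) (nu_neq0 5) (nu_neq0 6) (nu_neq0 7) (nu_neq0 8)
  kappa1_neq0 kappa2_neq0 f_neq0 g_neq0
  (g_nu_neq0 (isT : 1 <= 8)%N) (g_nu_neq0 (isT : 2 <= 8)%N)
  (g_nu_neq0 (isT : 3 <= 8)%N) (g_nu_neq0 (isT : 4 <= 8)%N)
  (g_kappa2_nu_neq0 (isT : 5 <= 8)%N) (g_kappa2_nu_neq0 (isT : 6 <= 8)%N)
  (g_kappa2_nu_neq0 (isT : 7 <= 8)%N) (g_kappa2_nu_neq0 (isT : 8 <= 8)%N)
  fg_neq1 fg_kappa_neq0
  half_T_acts half_T_ratio XiP.2 T_comp).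
Qed.

(** Supplies the inverse evolution required by [qPE7]. *)
Lemma T_bij : bijective (@T F).
Proof.
have bij_half : bijective (@half_T F).
  have b0 := inverse_subst_bij s0P.1.
  have b1 := inverse_subst_bij s1P.1.
  have b2 := inverse_subst_bij s2P.1.
  have b3 := inverse_subst_bij s3P.1.
  have b4 := inverse_subst_bij s4P.1.
  have b5 := inverse_subst_bij s5P.1.
  have b6 := inverse_subst_bij s6P.1.
  have b7 := inverse_subst_bij s7P.1.
  exact: (bij_comp (bij_comp (bij_comp (bij_comp (bij_comp (bij_comp (bij_comp
    (bij_comp (bij_comp (bij_comp (bij_comp (bij_comp (bij_comp (bij_comp
    (bij_comp (bij_comp b4 b5) b3) b4) b6) b5) b2) b3) b4) b7) b6) b5) b1)
    b2) b3) b4) b0).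
exact: (bij_comp (inverse_subst_bij XiP.1) (bij_comp bij_half bij_half)).
Qed.

End Generators.

(** * Comparison of Xi with S_{E_7}, and the q-Painleve equation *)

Section TimeEvolution.

Context {F : fieldType}.
Local Notation c := (kappa1 / (q * kappa2) : ratfun F).

Lemma Xi_SE7_generators :
  map Xi SE7_generators = map SE7_Xi (@SE7_generators F).
Proof.
exact: (X_SE7 (S := SE7_Xi) qE (nu_neq0 1) (nu_neq0 2) (nu_neq0 3) (nu_neq0 4) (nu_neq0 5)
  (nu_neq0 6) (nu_neq0 7) (nu_neq0 8) kappa1_neq0 kappa2_neq0 XiP.2 SE7P.2).
Qed.

(** Reduces the comparison of Xi with S_{E_7}[c] to constants and the eleven generators. *)
Lemma rmorph_generated_ext (u v : {rmorphism ratfun F -> ratfun F}) s :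
    (forall a, u (cst a) = v (cst a)) -> map u s = map v s ->
  forall x, generated s x -> u x = v x.
Proof.
move=> uv_cst /eq_in_map uv x; elim=> {x}
  [a|x /uv|x y _ IHx _ IHy|x _ IHx|x y _ IHx _ IHy|x _ IHx] //.
- by rewrite !rmorphD IHx IHy.
- by rewrite !rmorphN IHx.
- by rewrite !rmorphM IHx IHy.
- by rewrite !fmorphV IHx.
Qed.

Lemma Xi_SE7 zeta : generated SE7_generators zeta -> Xi zeta = SE7 c zeta.
Proof.
apply: (@rmorph_generated_ext Xi SE7_Xi) Xi_SE7_generators zeta => a.
exact: (etrans (inverse_subst_cst XiP.1 a)
               (esym (inverse_subst_cst SE7P.1 a))).
Qed.

Lemma T_nu i : (1 <= i <= 8)%N -> T (nu i) = nu i :> ratfun F.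
Proof. by do 9?[case: i => [|i] //] => _; rewrite T_ratfun_acts. Qed.

Lemma T_qPE7 : exists Tinv : ratfun F -> ratfun F, qPE7 T Tinv.
Proof.
have [Tinv TK KT] := @T_bij F; exists Tinv; split.
- by split.
- rewrite /index_iota /= !big_cons !big_nil !mulr1 !mulrA.
  (* [qPE7] lists the factors in f before those in T(f). *)
  rewrite [(f * g - _) * _]mulrC [(f * g - 1) * _]mulrC.
  exact: T_ratfun_f_equation.
- rewrite /index_iota /= !big_cons !big_nil !mulr1 !mulrA.
  (* Here u is [Tinv g], and T(u) = g by [KT]. *)
  exact: ratfun_fg_equation (KT g).
by split; [exact: T_ratfun_acts.1.1.1.2 | exact: T_ratfun_acts.1.1.2 | exact: T_nu].
Qed.

End TimeEvolution.

Theorem theorem4p1 (F : fieldType) :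
  (((T f * g - kappa1 / (q * kappa2)) * (f * g - kappa1 / kappa2))
     / ((T f * g - 1) * (f * g - 1))
   = ((g - nu 5 / kappa2) * (g - nu 6 / kappa2)
      * (g - nu 7 / kappa2) * (g - nu 8 / kappa2))
     / ((g - 1 / nu 1) * (g - 1 / nu 2) * (g - 1 / nu 3) * (g - 1 / nu 4))
     :> ratfun F)
  /\ (((T g * T f - kappa1 / (q ^+ 2 * kappa2))
         * (T f * g - kappa1 / (q * kappa2)))
      / ((T g * T f - 1) * (T f * g - 1))
      = ((T f - T (kappa1 / nu 5)) * (T f - T (kappa1 / nu 6))
         * (T f - T (kappa1 / nu 7)) * (T f - T (kappa1 / nu 8)))
        / ((T f - nu 1) * (T f - nu 2) * (T f - nu 3) * (T f - nu 4))
      :> ratfun F)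
  /\ (exists Tinv : ratfun F -> ratfun F, qPE7 T Tinv)
  /\ (forall i : nat, (1 <= i <= 8)%N -> T (nu i) = nu i :> ratfun F)
  /\ T kappa1 = kappa1 / q :> ratfun F
  /\ T kappa2 = q * kappa2 :> ratfun F
  /\ (forall zeta : ratfun F, generated SE7_generators zeta ->
        Xi zeta = SE7 (kappa1 / (q * kappa2)) zeta).
Proof.
split; first exact: T_ratfun_f_equation.
split; first exact: T_ratfun_g_equation.
split; first exact: T_qPE7.
split; first exact: T_nu.
split; first exact: T_ratfun_acts.1.1.1.2.
split; first exact: T_ratfun_acts.1.1.2.
exact: Xi_SE7.
Qed.
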